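(* Let $\gamma$ be an $n\times m$ integer matrix satisfying conditions (i) and (ii) for the sign $-$, and let $A=\mathcal{A}(\gamma)^-$. For $g\in\mathbb{Z}^m$ put $|g|=\sum_{i=1}^m|g_i|$. Then $A_g\neq0$ if and only if there is a sequence $(i_1,\dots,i_N)$ with $N=|g|$ of elements of $\{1,\dots,m\}$ in which each $i$ occurs exactly $|g_i|$ times (so that the vectors $\mathrm{sgn}(g_{i_k})\gamma(\mathbf{e}_{i_k})$, $k=1,\dots,N$, form an $n$-dimensional vector composition of $\gamma(g)$), such that for every $r\in\{p+1,\dots,n\}$ the sequence $\big(\mathrm{sgn}(g_{i_1})\gamma_{ri_1},\dots,\mathrm{sgn}(g_{i_N})\gamma_{ri_N}\big)$ contains no block of consecutive entries of the form $(1,0,\dots,0,1)$ or $(-1,0,\dots,0,-1)$ (with zero or more $0$'s in between).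
   Context: $\Bbbk$ is an algebraically closed field of characteristic $0$. Fix $p,q\ge0$, $n=p+q$; $p(i)=0$ for $i\le p$, $p(i)=1$ for $i>p$. With the sign $-$: $\lambda_{ij}=(-1)^{p(i)p(j)}$, so $\lambda_{jj}=-1$ exactly for $j>p$; $R=\Bbbk[u_1,\dots,u_n]/(u_j^2-u_j\mid j>p)$; $\tau_i\in\mathrm{Aut}(R)$ with $\tau_i(u_i)=\lambda_{ii}(u_i-1)$, $\tau_i(u_j)=u_j$ ($j\ne i$). TGW algebras: for a TGW datum $(R,\sigma,t)$ (commuting automorphisms $\sigma_i$, central $t_i$) and nonzero scalars $\mu_{ij}$ ($i\ne j$), $\mathcal{A}_\mu(R,\sigma,t)$ is the quotient of the $R$-ring generated by $X_i,Y_i$ with relations $X_ir=\sigma_i(r)X_i$, $Y_ir=\sigma_i^{-1}(r)Y_i$, $Y_iX_i=t_i$, $X_iY_i=\sigma_i(t_i)$, $X_iY_j=\mu_{ij}Y_jX_i$ ($i\ne j$), graded by $\deg X_i=\mathbf{e}_i=-\deg Y_i$, $\deg R=0$, by the largest graded ideal meeting the degree-zero part trivially. The family $\mathcal{A}(\gamma)^-$: $\gamma=(\gamma_{ji})$ is an $n\times m$ integer matrix with (i) $|\gamma_{ji}|\le1$ whenever $\lambda_{jj}=-1$, and (ii) for all $i\ne i'$, either $\gamma_{ki}\gamma_{ki'}<0$ for some $k$ with $\lambda_{kk}=-1$, or $\gamma_{ki}\gamma_{ki'}\le0$ for all $k$. Then $\mathcal{A}(\gamma)^-=\mathcal{A}_\mu(R,\sigma,t)$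 with index set $\{1,\dots,m\}$, $\sigma_i=\tau_1^{\gamma_{1i}}\cdots\tau_n^{\gamma_{ni}}$, $t_i=\prod_{j=1}^nu_{ji}$ with $u_{ji}=(u_j+\gamma_{ji}-1)\cdots(u_j+1)u_j$ if $\gamma_{ji}>0$, $1$ if $\gamma_{ji}=0$, $(u_j-|\gamma_{ji}|)\cdots(u_j-1)$ if $\gamma_{ji}<0$; and $\mu_{ij}=(-1)^{\bar p(i)\bar p(j)}$ with $\bar p(i)=\sum_k\gamma_{ki}p(k)\bmod2$. $\gamma(\mathbf{e}_i)$ denotes the $i$-th column of $\gamma$, and $\mathrm{sgn}$ is the sign function. *)

(* Defs.v *)
From HB Require Import structures.
From mathcomp Require Import all_boot all_order all_algebra.
Set Implicit Arguments. Unset Strict Implicit. Unset Printing Implicit Defensive.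
Import Order.TTheory GRing.Theory Num.Theory.
Local Open Scope ring_scope.

(* Indices are 0-based: u_j for j : 'I_(p+q), "j > p" (1-based) becomes
   "p <= j" (0-based); X_i, Y_i for i : 'I_m. *)

Section TGW.
Variable K : fieldType.
Variables p q m : nat.
Local Notation n := (p + q)%N.
Variable gam : 'M[int]_(n, m).

Definition letter := ('I_n + ('I_m + 'I_m))%type.
Definition word := seq letter.

(* Elements of the free associative K-algebra K<u,X,Y> represented as formal
   finite linear combinations of words; two formal sums represent the same
   element iff all their coefficients agree (feq). *)
Definition fsum := seq (K * word).
Definition coef (f : fsum) (w : word) : K := \sum_(x <- f | x.2 == w) x.1.
Definition feq (f g : fsum) : Prop := forall w, coef f w = coef g w.

Definition fadd (f g : fsum) : fsum := f ++ g.
Definition fscale (c : K) (f : fsum) : fsum := [seq (c * x.1, x.2) | x <- f].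
Definition fsub (f g : fsum) : fsum := f ++ fscale (-1) g.
Definition fmul (f g : fsum) : fsum :=
  [seq (x.1 * y.1, x.2 ++ y.2) | x <- f, y <- g].
Definition fconst (c : K) : fsum := [:: (c, [::])].
Definition fone : fsum := fconst 1.
Definition fletter (l : letter) : fsum := [:: (1, [:: l])].
Definition fU (j : 'I_n) : fsum := fletter (inl j).
Definition fX (i : 'I_m) : fsum := fletter (inr (inl i)).
Definition fY (i : 'I_m) : fsum := fletter (inr (inr i)).

(* elements of R = K[u_1..u_n]/(...) : combinations of words in the u's only *)
Definition is_u (l : letter) : bool := if l is inl _ then true else false.
Definition isR (f : fsum) : bool := all (fun x => all is_u x.2) f.

Definition subst_letter (phi : 'I_n -> fsum) (l : letter) : fsum :=
  match l with inl j => phi j | _ => fletter l end.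
Definition subst_word (phi : 'I_n -> fsum) (w : word) : fsum :=
  foldr (fun l acc => fmul (subst_letter phi l) acc) fone w.
Definition subst (phi : 'I_n -> fsum) (f : fsum) : fsum :=
  flatten [seq fscale x.1 (subst_word phi x.2) | x <- f].

Definition lam (j : 'I_n) : K := if (p <= j)%N then -1 else 1.
Definition tau (j : 'I_n) : 'I_n -> fsum :=
  fun k => if k == j then fscale (lam j) (fsub (fU j) fone) else fU k.
Definition tauinv (j : 'I_n) : 'I_n -> fsum :=
  fun k => if k == j then fadd (fscale (lam j) (fU j)) fone else fU k.
Definition taupow (j : 'I_n) (c : int) (f : fsum) : fsum :=
  match c with
  | Posz k => iter k (subst (tau j)) f
  | Negz k => iter k.+1 (subst (tauinv j)) f
  end.
Definition sigma (i : 'I_m) (f : fsum) : fsum :=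
  foldr (fun j acc => taupow j (gam j i) acc) f (enum 'I_n).
Definition sigmainv (i : 'I_m) (f : fsum) : fsum :=
  foldr (fun j acc => taupow j (- gam j i) acc) f (rev (enum 'I_n)).

Definition uji (j : 'I_n) (i : 'I_m) : fsum :=
  match gam j i with
  | Posz k => foldr fmul fone
                [seq fadd (fU j) (fconst l%:R) | l <- rev (iota 0 k)]
  | Negz k => foldr fmul fone
                [seq fsub (fU j) (fconst l%:R) | l <- rev (iota 1 k.+1)]
  end.
Definition tt (i : 'I_m) : fsum := foldr fmul fone [seq uji j i | j <- enum 'I_n].

Definition pbar (i : 'I_m) : bool := odd (absz (\sum_(k < n | (p <= k)%N) gam k i)).
Definition mu (i j : 'I_m) : K := if pbar i && pbar j then -1 else 1.

(* Defining relations of the R-ring (as K-algebra generated by u, X, Y) *)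
Definition Rel (f : fsum) : Prop :=
  (exists a b : 'I_n, f = fsub (fmul (fU a) (fU b)) (fmul (fU b) (fU a)))
  \/ (exists j : 'I_n, (p <= j)%N /\ f = fsub (fmul (fU j) (fU j)) (fU j))
  \/ (exists i r, isR r /\ f = fsub (fmul (fX i) r) (fmul (sigma i r) (fX i)))
  \/ (exists i r, isR r /\ f = fsub (fmul (fY i) r) (fmul (sigmainv i r) (fY i)))
  \/ (exists i, f = fsub (fmul (fY i) (fX i)) (tt i))
  \/ (exists i, f = fsub (fmul (fX i) (fY i)) (sigma i (tt i)))
  \/ (exists i j, i != j /\
        f = fsub (fmul (fX i) (fY j)) (fscale (mu i j) (fmul (fY j) (fX i)))).

Definition ideal (P : fsum -> Prop) : Prop :=
  [/\ (forall f g, feq f g -> P f -> P g),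
      P [::],
      (forall f g, P f -> P g -> P (fadd f g)) &
      (forall f a b, P f -> P (fmul (fmul a f) b))].

Definition Krel (f : fsum) : Prop :=
  forall P, ideal P -> (forall r, Rel r -> P r) -> P f.

Definition ldeg (l : letter) (i : 'I_m) : int :=
  match l with
  | inl _ => 0
  | inr (inl k) => (k == i)%:Z
  | inr (inr k) => - (k == i)%:Z
  end.
Definition deg (w : word) (i : 'I_m) : int := \sum_(l <- w) ldeg l i.
Definition homog (g : 'I_m -> int) (f : fsum) : Prop :=
  forall w, coef f w != 0 -> forall i, deg w i = g i.
Definition component (g : 'I_m -> int) (f : fsum) : fsum :=
  [seq x <- f | [forall i, deg x.2 i == g i]].
Definition graded (P : fsum -> Prop) : Prop :=
  forall f g, P f -> P (component g f).

(* Graded ideals of C = K<u,X,Y>/Krel correspond to graded ideals J of the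
   free algebra containing Krel; "J/Krel meets C_0 trivially" means every
   degree-0 element of J lies in Krel. *)
Definition admissible (J : fsum -> Prop) : Prop :=
  [/\ ideal J, graded J, (forall f, Krel f -> J f) &
      (forall f, J f -> homog (fun _ => 0) f -> Krel f)].

(* membership in the largest such ideal (the union of all admissible ideals,
   which is directed, hence equals their sum) *)
Definition inI (f : fsum) : Prop := exists J, admissible J /\ J f.

Definition A_nonzero (g : 'I_m -> int) : Prop :=
  exists f, homog g f /\ ~ inI f.

End TGW.

Definition gamma_cond (p q m : nat) (gam : 'M[int]_(p + q, m)) : Prop :=
  (forall (j : 'I_(p + q)) (i : 'I_m), (p <= j)%N -> `|gam j i| <= 1)
  /\ (forall i i' : 'I_m, i != i' ->
        (exists k : 'I_(p + q), (p <= k)%N /\ gam k i * gam k i' < 0)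
        \/ (forall k : 'I_(p + q), gam k i * gam k i' <= 0)).

Definition has_bad_block (a : seq int) : Prop :=
  exists k l : nat, (k < l < size a)%N /\
    ((nth 0 a k = 1 /\ nth 0 a l = 1) \/ (nth 0 a k = -1 /\ nth 0 a l = -1)) /\
    (forall t : nat, (k < t < l)%N -> nth 0 a t = 0).

(* Main.v *)
Require Import Defs.
From HB Require Import structures.
From mathcomp Require Import all_boot all_order all_algebra.
From mathcomp Require Import ring zify.
From Stdlib Require Import Setoid Morphisms Classical.
Import Order.TTheory GRing.Theory Num.Theory.
Set Implicit Arguments. Unset Strict Implicit. Unset Printing Implicit Defensive.
Local Open Scope ring_scope.

(** The algebra acts on a Fock space: K-valued functions on the lattice of
    weights [Z^n], on which [u_j] is diagonal and [X_i], [Y_i] translate by plus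
    or minus the [i]-th column of [gam], up to coefficients.  A bosonic [u_j]
    has spectrum [Z + 1/2], so bosonic coefficients never vanish; a fermionic
    [u_j] is the parity of the [j]-th coordinate, so a word acts by zero exactly
    when one of its fermionic rows has two equal nonzero entries separated only
    by zeros.  Recording also the [Z^m]-degree makes the annihilator of the
    module a graded ideal.  Its degree-zero part is trivial: each word reduces to
    an element of [R] times a word of [Y]'s followed by [X]'s with disjoint
    indices, so in degree zero only [R] is left, and [R] acts faithfully.

    If [A_g] is nonzero, some word of degree [g] acts nontrivially, hence so does
    its reduced form, whose letters spell the required sequence.  Conversely a
    sequence without bad blocks spells a word [w] that acts nontrivially from a
    suitable weight, and then so does [w' w] of degree zero, where [w'] is [w]
    reversed with [X] and [Y] exchanged. *)

(** * Formal sums *)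

Section FormalSums.
Variable K : fieldType.
Variables p q m : nat.
Local Notation n := (p + q)%N.
Local Notation word := (word p q m).
Local Notation letter := (letter p q m).
Local Notation fsum := (fsum K p q m).
Implicit Types (f g h r : fsum) (v w : word) (F : word -> K).

(** The linear extension of [F] from words to formal sums. Pairing with every [F] determines the
    element represented, so identities in the free algebra become identities between scalars. *)
Definition pairing f F : K := \sum_(x <- f) x.1 * F x.2.

Definition mon w : fsum := [:: (1, w)].

Lemma eq_pairing f F G : F =1 G -> pairing f F = pairing f G.
Proof. by move=> e; apply: eq_bigr => x _; rewrite e. Qed.

Lemma pairing_coef f F :
  pairing f F = \sum_(w <- undup [seq x.2 | x <- f]) coef f w * F w.
Proof.
under [RHS]eq_bigr => w _ do rewrite /coef big_mkcond big_distrl /=.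
rewrite exchange_big /= /pairing !big_seq; apply: eq_bigr => x xf.
rewrite (bigD1_seq x.2) ?undup_uniq //=; last by rewrite mem_undup map_f.
rewrite eqxx big1 ?addr0 // => w wx; rewrite eq_sym (negbTE wx) mul0r //.
Qed.

Lemma coef_pairing f w : coef f w = pairing f (fun v => (v == w)%:R).
Proof.
rewrite /coef big_mkcond; apply: eq_bigr => x _.
by case: eqP => _; rewrite ?mulr1 ?mulr0.
Qed.

Lemma coef_notin f w : w \notin [seq x.2 | x <- f] -> coef f w = 0.
Proof.
move=> wf; rewrite /coef big_seq_cond big1 // => x /andP[xf /eqP xw].
by move: wf; rewrite -xw map_f.
Qed.

Lemma feq_pairing f g : feq f g <-> (forall F, pairing f F = pairing g F).
Proof.
split=> [fg F|fg w]; last by rewrite !coef_pairing.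
(* Both sums are expanded over one duplicate-free list containing all their words. Extra words carry
   coefficient zero. *)
pose s := undup ([seq x.2 | x <- f] ++ [seq x.2 | x <- g]).
suff ext h : {subset [seq x.2 | x <- h] <= s} ->
    pairing h F = \sum_(w <- s) coef h w * F w.
  rewrite !ext; last 2 first.
  - by move=> w wf; rewrite mem_undup mem_cat wf orbT.
  - by move=> w wf; rewrite mem_undup mem_cat wf.
  by apply: eq_bigr => w _; rewrite fg.
move=> hs; rewrite pairing_coef [RHS](bigID (mem [seq x.2 | x <- h])) /=.
rewrite [X in _ + X]big1 ?addr0; last first.
  by move=> w wh; rewrite coef_notin ?mul0r.
rewrite -[RHS]big_filter; apply: perm_big; apply: uniq_perm.
- exact: undup_uniq.
- by rewrite filter_uniq ?undup_uniq.
by move=> w; rewrite mem_undup mem_filter /=; case: (boolP (w \in _)) => // /hs.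
Qed.

Lemma pairing_nil F : pairing [::] F = 0. Proof. exact: big_nil. Qed.
Lemma pairing_cons x f F : pairing (x :: f) F = x.1 * F x.2 + pairing f F.
Proof. exact: big_cons. Qed.
Lemma pairing_mon w F : pairing (mon w) F = F w.
Proof. by rewrite /pairing big_seq1 mul1r. Qed.
Lemma pairing_fletter (l : letter) F : pairing (fletter K l) F = F [:: l].
Proof. exact: pairing_mon. Qed.
Lemma pairing_fU j F : pairing (fU K m j) F = F [:: inl j].
Proof. exact: pairing_mon. Qed.
Lemma pairing_fX i F : pairing (fX K p q i) F = F [:: inr (inl i)].
Proof. exact: pairing_mon. Qed.
Lemma pairing_fY i F : pairing (fY K p q i) F = F [:: inr (inr i)].
Proof. exact: pairing_mon. Qed.
Lemma pairing_fconst c F : pairing (fconst p q m c) F = c * F [::].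
Proof. by rewrite /pairing big_seq1. Qed.
Lemma pairing_fone F : pairing (fone K p q m) F = F [::].
Proof. by rewrite /fone pairing_fconst mul1r. Qed.
Lemma pairing_fadd f g F : pairing (fadd f g) F = pairing f F + pairing g F.
Proof. exact: big_cat. Qed.
Lemma pairing_fscale c f F : pairing (fscale c f) F = c * pairing f F.
Proof.
by rewrite /pairing big_map big_distrr /=; apply: eq_bigr => x _; rewrite mulrA.
Qed.
Lemma pairing_fsub f g F : pairing (fsub f g) F = pairing f F - pairing g F.
Proof.
by rewrite -[fsub f g]/(fadd f (fscale (-1) g)) pairing_fadd pairing_fscale mulN1r.
Qed.
Lemma pairing_fmul f g F :
  pairing (fmul f g) F = pairing f (fun w => pairing g (fun v => F (w ++ v))).
Proof.
rewrite /pairing /fmul big_allpairs_dep /=; apply: eq_bigr => x _.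
by rewrite big_distrr /=; apply: eq_bigr => y _; rewrite mulrA.
Qed.

Lemma pairing_scalel f F c : pairing f (fun w => c * F w) = c * pairing f F.
Proof. by rewrite /pairing big_distrr; apply: eq_bigr => x _; rewrite mulrCA. Qed.

Lemma pairing_scaler f F c : pairing f (fun w => F w * c) = pairing f F * c.
Proof. by rewrite mulrC -pairing_scalel; apply: eq_pairing => w; rewrite mulrC. Qed.

Lemma pairing_sub f F G : pairing f (fun w => F w - G w) = pairing f F - pairing f G.
Proof.
by rewrite /pairing -sumrB; apply: eq_bigr => x _; rewrite mulrBr.
Qed.

Definition pairingE := (pairing_nil, pairing_fadd, pairing_fsub, pairing_fscale, pairing_fmul,
  pairing_mon, pairing_fU, pairing_fX, pairing_fY, pairing_fconst, pairing_fone, pairing_fletter).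

#[export] Instance feq_equiv : Equivalence (@feq K p q m).
Proof.
split=> [f w //|f g fg w|f g h fg gh w]; first by rewrite fg.
by rewrite fg gh.
Qed.

#[export] Instance fmul_feq :
  Proper (@feq K p q m ==> @feq K p q m ==> @feq K p q m) (@fmul K p q m).
Proof.
move=> f f' /feq_pairing ff' g g' /feq_pairing gg'; apply/feq_pairing => F.
by rewrite !pairing_fmul ff'; apply: eq_pairing => w; rewrite gg'.
Qed.

Lemma fmulA f g h : feq (fmul f (fmul g h)) (fmul (fmul f g) h).
Proof.
apply/feq_pairing => F; rewrite !pairingE; apply: eq_pairing => w; rewrite !pairingE.
by apply: eq_pairing => v; apply: eq_pairing => u; rewrite catA.
Qed.

Lemma fmul1f f : feq (fmul (fone K p q m) f) f.
Proof. by apply/feq_pairing => F; rewrite !pairingE. Qed.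

Lemma fmulf1 f : feq (fmul f (fone K p q m)) f.
Proof.
by apply/feq_pairing => F; rewrite !pairingE; apply: eq_pairing => w; rewrite pairingE cats0.
Qed.

Lemma mon_cat v w : feq (mon (v ++ w)) (fmul (mon v) (mon w)).
Proof. by apply/feq_pairing => F; rewrite !pairingE. Qed.

Lemma mon_cons l w : feq (mon (l :: w)) (fmul (mon [:: l]) (mon w)).
Proof. exact: (mon_cat [:: l]). Qed.

Section Ideal.
Variable P : fsum -> Prop.
Hypothesis idP : ideal P.

Lemma ideal_feq f g : feq f g -> P f -> P g.
Proof. by case: idP => H _ _ _; exact: H. Qed.
Lemma ideal0 : P [::]. Proof. by case: idP. Qed.
Lemma idealD f g : P f -> P g -> P (fadd f g).
Proof. by case: idP => _ _ H _; exact: H. Qed.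
Lemma fidealMl f g : P g -> P (fmul f g).
Proof.
case: idP => H _ _ M Pg; apply: (H _ _ _ (M _ f (fone K p q m) Pg)).
exact: fmulf1.
Qed.
Lemma fidealMr f g : P f -> P (fmul f g).
Proof.
case: idP => H _ _ M Pf; apply: (H _ _ _ (M _ (fone K p q m) g Pf)).
by rewrite fmul1f.
Qed.
Lemma idealZ c f : P f -> P (fscale c f).
Proof.
move=> Pf; apply: (@ideal_feq (fmul (fconst p q m c) f)); last exact: fidealMl.
by apply/feq_pairing => F; rewrite !pairingE.
Qed.
Lemma ideal_sum (I : Type) (s : seq I) (F : I -> fsum) :
  (forall i, P (F i)) -> P (flatten [seq F i | i <- s]).
Proof.
move=> PF; elim: s => [|i s IH] /=; first exact: ideal0.
exact: idealD.
Qed.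
End Ideal.

Lemma isR_fadd f g : isR f -> isR g -> isR (fadd f g).
Proof. by rewrite /isR all_cat => -> ->. Qed.
Lemma isR_fscale c f : isR f -> isR (fscale c f).
Proof. by rewrite /isR all_map; apply: sub_all => x. Qed.
Lemma isR_fsub f g : isR f -> isR g -> isR (fsub f g).
Proof. by move=> Rf Rg; apply: isR_fadd => //; apply: isR_fscale. Qed.
Lemma isR_fmul f g : isR f -> isR g -> isR (fmul f g).
Proof.
move=> /allP Rf /allP Rg; apply/allP => _ /allpairsP[[x y] [/= xf yg ->]] /=.
by rewrite all_cat (Rf _ xf) (Rg _ yg).
Qed.
Lemma isR_prod (s : seq fsum) : all (@isR K p q m) s ->
  isR (foldr (@fmul K p q m) (fone K p q m) s).
Proof. by elim: s => //= f s IH /andP[Rf /IH]; exact: isR_fmul. Qed.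
Lemma isR_subst (phi : 'I_n -> fsum) f :
  (forall j, isR (phi j)) -> isR f -> isR (subst phi f).
Proof.
move=> Rphi; elim: f => //= -[c w] f IH /andP[/= Rw /IH Rf].
apply: isR_fadd => //; apply: isR_fscale.
elim: w Rw {IH Rf} => //= -[j|//] w IH /= /IH.
exact: isR_fmul.
Qed.

End FormalSums.

(** * Evaluation of the subring R *)

Lemma odd_absz_sub (x y : int) :
  odd (absz (x - y)) = odd (absz x) (+) odd (absz y).
Proof. lia. Qed.

Section Factors.
Variable K : fieldType.

(* [fac e d x] is the coefficient of a move by [d] in one coordinate (fermionic
   iff [e]) whose target has [u]-eigenvalue [x]; [ushift e d x] is then the
   eigenvalue at the source.  For a boson, moving up is multiplication by
   [x^d] and moving down is a [|d|]-fold derivative.  For a fermion both only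
   make sense when [|d| <= 1]. *)
Definition fac (e : bool) (d : int) (x : K) : K :=
  if e then (if d == 0 then 1 else if 0 < d then 1 - x else x)
  else if 0 <= d then 1 else \prod_(l < absz d) (x + l%:R).

Definition ushift (e : bool) (d : int) (x : K) : K :=
  if e then (if odd (absz d) then 1 - x else x) else x - d%:~R.

Lemma fac0 e x : fac e 0 x = 1. Proof. by case: e. Qed.
Lemma ushift0 e x : ushift e 0 x = x. Proof. by rewrite /ushift; case: e; rewrite //= subr0. Qed.

Lemma fac_npos (d : int) x :
  d <= 0 -> fac false d x = \prod_(l < absz d) (x + l%:R).
Proof.
rewrite /fac; case: ifP => // d0 d0'.
by have -> : d = 0; [lia | rewrite big_ord0].
Qed.

(** Moves pointing weakly the same way commute. Two nonzero fermionic moves are then equal, and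
    upward bosonic moves have coefficient 1. Downward bosonic moves concatenate, in either order, to
    one product of [|d| + |d'|] consecutive factors starting at [x]. *)
Lemma fac_comm (e : bool) (d d' : int) x :
  (e -> `|d| <= 1 /\ `|d'| <= 1) -> 0 <= d * d' ->
  fac e d x * fac e d' (ushift e d x) = fac e d' x * fac e d (ushift e d' x).
Proof.
case: e => [/(_ isT) [h h'] dd'|_ dd'].
  have [->|nd] := eqVneq d 0; first by rewrite ushift0 !fac0 mulr1 mul1r.
  have [->|nd'] := eqVneq d' 0; first by rewrite ushift0 !fac0 mulr1 mul1r.
  by have -> : d = d' by nia.
have [le0|] := boolP ((d <= 0) && (d' <= 0)); last first.
  move=> nle; have [h h'] : 0 <= d /\ 0 <= d' by nia.
  by rewrite /fac h h'.
case/andP: le0 => h h'; rewrite !fac_npos //=.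
have splitP a b : \prod_(l < a) (x + l%:R) * \prod_(l < b) (x + a%:R + l%:R)
    = \prod_(l < a + b) (x + l%:R).
  rewrite big_split_ord /=; congr (_ * _); apply: eq_bigr => l _.
  by rewrite natrD addrA.
have shE z : z <= 0 -> x - z%:~R = x + (absz z)%:R.
  move=> z0; have -> : (absz z)%:R = (- z)%:~R :> K.
      by rewrite pmulrn; congr (_ *~ _); lia.
    by rewrite mulrNz.
by rewrite /ushift !shE // !splitP addnC.
Qed.

(** Pauli exclusion: the product is [x (1 - x)] up to order, which vanishes for idempotent [x]. *)
Lemma fac_fermion_sq (d : int) x : d != 0 -> `|d| <= 1 -> x * x = x ->
  fac true d x * fac true d (ushift true d x) = 0.
Proof.
move=> d0 d1 xx; rewrite /fac /ushift (negbTE d0).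
have -> : odd `|d| by have -> : `|d|%N = 1%N by lia.
by case: ifP => _; rewrite ?subKr; ring: xx.
Qed.

End Factors.
Arguments fac : simpl never.
Arguments ushift : simpl never.

Section Evaluation.
Variable K : fieldType.
Variables p q m : nat.
Local Notation n := (p + q)%N.
Local Notation word := (word p q m).
Local Notation letter := (letter p q m).
Local Notation fsum := (fsum K p q m).
Implicit Types (f g h r : fsum) (v w : word) (b d : 'cV[int]_n) (j : 'I_n).

(* The shift by 1/2 keeps bosonic eigenvalues away from the zeros of all
   coefficients. *)
Definition uval b j : K :=
  if (p <= j)%N then (odd (absz (b j 0)))%:R else (b j 0)%:~R + 2^-1.

Lemma uval_sub b d j :
  uval (b - d) j = ushift (p <= j)%N (d j 0) (uval b j).
Proof.
rewrite /uval /ushift !mxE; case: ifP => _; last by rewrite rmorphB /= addrAC.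
rewrite odd_absz_sub.
by case: (odd (absz (d j 0)%R)); case: (odd _); rewrite /= ?subr0 ?subrr.
Qed.

Lemma uval_add b d j :
  uval (b + d) j = ushift (p <= j)%N (- d j 0) (uval b j).
Proof. by rewrite -[d in b + d]opprK uval_sub mxE. Qed.

Lemma uval_sq b j : (p <= j)%N -> uval b j * uval b j = uval b j.
Proof. by rewrite /uval => ->; case: odd; rewrite ?mulr1 ?mulr0. Qed.

(** Sending the letters [X_i] and [Y_i] to 0 makes [ev b] an algebra morphism on the whole free
    algebra. On [R] it is the character attached to the weight [b]. *)
Definition evw b w : K :=
  \prod_(l <- w) (if l is inl j then uval b j else 0).
Definition ev b f : K := pairing f (evw b).

Lemma ev_mul b f g : ev b (fmul f g) = ev b f * ev b g.
Proof.
rewrite /ev pairingE -pairing_scaler; apply: eq_pairing => w.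
by rewrite -pairing_scalel; apply: eq_pairing => v; rewrite /evw big_cat.
Qed.
Lemma ev_add b f g : ev b (fadd f g) = ev b f + ev b g.
Proof. exact: pairing_fadd. Qed.
Lemma ev_sub b f g : ev b (fsub f g) = ev b f - ev b g.
Proof. exact: pairing_fsub. Qed.
Lemma ev_scale b c f : ev b (fscale c f) = c * ev b f.
Proof. exact: pairing_fscale. Qed.
Lemma ev_const b c : ev b (fconst p q m c) = c.
Proof. by rewrite /ev pairingE /evw big_nil mulr1. Qed.
Lemma ev_one b : ev b (fone K p q m) = 1.
Proof. exact: ev_const. Qed.
Lemma ev_U b j : ev b (fU K m j) = uval b j.
Proof. by rewrite /ev pairingE /evw big_seq1. Qed.
Lemma ev_prod b (s : seq fsum) :
  ev b (foldr (@fmul K p q m) (fone K p q m) s) = \prod_(f <- s) ev b f.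
Proof.
by elim: s => [|f s IH] /=; rewrite ?big_nil ?ev_one // big_cons ev_mul IH.
Qed.

Definition evE := (ev_mul, ev_add, ev_sub, ev_scale, ev_const, ev_one, ev_U).

(** Both sides are algebra morphisms, so agreement on the [u_j] suffices: substitution fixes the
    other letters, and these evaluate to 0. *)
Lemma ev_subst b b' (phi : 'I_n -> fsum) f :
  (forall j, ev b (phi j) = uval b' j) -> ev b (subst phi f) = ev b' f.
Proof.
move=> phiE; elim: f => [|[c w] f IH]; first by rewrite /ev !pairingE.
rewrite -[subst _ _]/(fadd (fscale c (subst_word phi w)) (subst phi f)).
rewrite ev_add IH ev_scale [RHS]pairing_cons /=; congr (_ * _ + _).
elim: w => [|l w IHw] /=; first by rewrite ev_one /evw big_nil.
rewrite ev_mul IHw /evw big_cons; congr (_ * _).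
case: l => [j|l] //=; rewrite /ev pairingE /evw big_seq1 //.
Qed.

(** Subtracting 1 from the [j]-th coordinate lowers a bosonic eigenvalue by 1 and flips a fermionic
    parity, as do [u_j - 1] and [-(u_j - 1)]. *)
Lemma ev_tau b j f : ev b (subst (tau K m j) f) = ev (b - delta_mx j 0) f.
Proof.
apply: ev_subst => k; rewrite uval_sub mxE eqxx andbT /tau.
case: eqP => [->|_]; last by rewrite ev_U ushift0.
rewrite !evE /lam /ushift; case: ifP => _ /=; last by rewrite mul1r.
by rewrite mulN1r opprB.
Qed.

Lemma ev_tauinv b j f : ev b (subst (tauinv K m j) f) = ev (b + delta_mx j 0) f.
Proof.
apply: ev_subst => k; rewrite uval_add mxE eqxx andbT /tauinv.
case: eqP => [->|_]; last by rewrite ev_U ushift0.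
rewrite !evE /lam /ushift; case: ifP => _ /=; last by rewrite mul1r opprK.
by rewrite mulN1r addrC.
Qed.

Lemma ev_taupow b j c f : ev b (taupow j c f) = ev (b - c *: delta_mx j 0) f.
Proof.
case: c => k /=.
  elim: k b => [|k IH] b; first by rewrite scale0r subr0.
  by rewrite iterS ev_tau IH intS scalerDl scale1r opprD addrA.
have -> : (Negz k : int) = - k.+1%:Z by [].
rewrite scaleNr opprK -[subst _ _]/(iter k.+1 _ f).
elim: k.+1 b => [|{}k IH] b; first by rewrite scale0r addr0.
by rewrite iterS ev_tauinv IH intS scalerDl scale1r addrA.
Qed.

Lemma isR_taupow j c f : isR f -> isR (taupow j c f).
Proof.
move=> Rf; have RT k : isR (tau K m j k).
  by rewrite /tau; case: ifP => // _; apply: isR_fscale; apply: isR_fsub.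
have RI k : isR (tauinv K m j k).
  by rewrite /tauinv; case: ifP => // _; apply: isR_fadd => //; apply: isR_fscale.
case: c => k; rewrite /taupow.
  by elim: k => //= k IH; apply: isR_subst.
by elim: k.+1 => //= {}k IH; apply: isR_subst.
Qed.

Lemma ev_taupow_foldr b (c : 'I_n -> int) (s : seq 'I_n) f :
  ev b (foldr (fun j acc => taupow j (c j) acc) f s)
  = ev (b - \sum_(j <- s) c j *: delta_mx j 0) f.
Proof.
elim: s b => [|j s IH] b /=; first by rewrite big_nil subr0.
by rewrite ev_taupow IH big_cons opprD addrA.
Qed.

Variable gam : 'M[int]_(n, m).

Lemma col_sum i : \sum_j gam j i *: delta_mx j 0 = col i gam.
Proof.
rewrite [RHS]matrix_sum_delta; apply: eq_bigr => j _.
by rewrite big_ord1 mxE.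
Qed.

Lemma ev_sigma b i f : ev b (sigma gam i f) = ev (b - col i gam) f.
Proof. by rewrite /sigma ev_taupow_foldr big_enum col_sum. Qed.

Lemma ev_sigmainv b i f : ev b (sigmainv gam i f) = ev (b + col i gam) f.
Proof.
rewrite /sigmainv (ev_taupow_foldr b (fun j => - gam j i)) -col_sum.
rewrite (perm_big (enum 'I_n)) ?perm_rev // big_enum /=.
by rewrite -sumrN; congr (ev (_ + _) _); apply: eq_bigr => j _; rewrite scaleNr opprK.
Qed.

Lemma isR_sigma i f : isR f -> isR (sigma gam i f).
Proof. by rewrite /sigma; elim: (enum _) => //= j s IH /IH; exact: isR_taupow. Qed.

Lemma isR_sigmainv i f : isR f -> isR (sigmainv gam i f).
Proof. by rewrite /sigmainv; elim: (rev _) => //= j s IH /IH; exact: isR_taupow. Qed.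

Lemma isR_tt i : isR (tt K gam i).
Proof.
apply: isR_prod; apply/allP => _ /mapP[j _ ->]; rewrite /uji.
case: (gam j i) => k; apply: isR_prod; apply/allP => _ /mapP[l _ ->] //.
Qed.

(** For a fermion with entry -1 the factor of [t_i] is [u_j - 1], whereas the two coefficients
    multiply to [1 - u_j]. This sign is the discrepancy. *)
Definition fermion_sign (e : bool) (d : int) : K :=
  if e && (d < 0) then -1 else 1.

(** The factor of [t_i] in coordinate [j] splits into a [Y] coefficient followed by an [X]
    coefficient, which is what [Y_i X_i = t_i] demands. *)
Lemma ev_uji b j i : ((p <= j)%N -> `|gam j i| <= 1) ->
  ev b (uji K gam j i) =
  fermion_sign (p <= j)%N (gam j i) * fac (p <= j)%N (- gam j i) (uval b j)
  * fac (p <= j)%N (gam j i) (ushift (p <= j)%N (- gam j i) (uval b j)).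
Proof.
rewrite /uji; case: (gam j i) => k h; rewrite ev_prod big_map.
- rewrite (perm_big (iota 0 k)) ?perm_rev //.
  under eq_bigr do rewrite !evE.
  rewrite -[k in iota 0 k]subn0 -/(index_iota 0 k) big_mkord.
  have [e|e] := boolP (p <= j)%N; rewrite /fermion_sign /= mul1r.
    have := h e; case: k h => [|[|k]] h // _.
      by rewrite big_ord0 -[Posz 0]/(0 : int) oppr0 !fac0 mulr1.
    rewrite big_ord_recl big_ord0 /fac /ushift /= addr0 mulr1 subKr.
    by rewrite uval_sq.
  rewrite fac_npos ?oppr_le0 // abszN absz_nat.
  by rewrite /fac /= mulr1.
- rewrite (perm_big (iota 1 k.+1)) ?perm_rev //.
  under eq_bigr do rewrite !evE.
  rewrite -[iota 1 _]/(index_iota 1 k.+2) big_add1 /= big_mkord.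
  have [e|e] := boolP (p <= j)%N; rewrite /fermion_sign /=.
    have := h e; case: k h => [|k] h // _.
    rewrite big_ord_recl big_ord0 /fac /ushift /=.
    have := uval_sq b e; move: (uval b j) => x xx.
    by ring: xx.
  (* Counting upwards from the shifted eigenvalue meets the same factors in reverse order. *)
  rewrite /fac /ushift mul1r mul1r (reindex_inj rev_ord_inj) /=.
  apply: eq_bigr => l _; have lk : (l <= k)%N by rewrite -ltnS.
  have -> : (- Negz k)%:~R = k.+1%:R :> K by [].
  have -> : (k.+1 - l.+1).+1%:R = k.+1%:R - l%:R :> K.
    by rewrite -natrB ?(ltnW (ltn_ord l)) //; congr _%:R; lia.
  by ring.
Qed.

End Evaluation.

(** * The Fock module *)

Section FockModule.
Variable K : fieldType.
Variables p q m : nat.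
Local Notation n := (p + q)%N.
Local Notation word := (word p q m).
Local Notation letter := (letter p q m).
Local Notation fsum := (fsum K p q m).
Variable gam : 'M[int]_(n, m).
Implicit Types (f g h r : fsum) (v w : word) (b d : 'cV[int]_n) (j : 'I_n)
  (i : 'I_m).
Local Notation ferm k := (p <= (k : 'I_n))%N.

(* The Jordan-Wigner sign [(-1)^(fermi_form d b)] makes fermions in distinct
   coordinates anticommute. *)
Definition fermi_form d b : int :=
  \sum_(k | ferm k) \sum_(l | ferm l && (l < k)%N) d k 0 * b l 0.

Lemma fermi_formDr d b b' :
  fermi_form d (b + b') = fermi_form d b + fermi_form d b'.
Proof.
rewrite -big_split; apply: eq_bigr => k _; rewrite -big_split.
by apply: eq_bigr => l _; rewrite mxE mulrDr.
Qed.

Lemma fermi_formN d b : fermi_form d (- b) = - fermi_form d b.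
Proof.
rewrite -sumrN; apply: eq_bigr => k _; rewrite -sumrN.
by apply: eq_bigr => l _; rewrite mxE mulrN.
Qed.

(** The product of the two total fermionic degrees is split over pairs of coordinates below, above
    and on the diagonal. *)
Lemma fermi_form_sym d b :
  fermi_form d b + fermi_form b d + \sum_(k | ferm k) d k 0 * b k 0
  = (\sum_(k | ferm k) d k 0) * (\sum_(k | ferm k) b k 0).
Proof.
rewrite mulrC big_distrlr /= /fermi_form (exchange_big_dep (fun k => ferm k)) /=;
  last by move=> k l _ /andP[].
rewrite -!big_split /=; apply: eq_bigr => k fk.
rewrite [RHS](bigID (fun l : 'I_n => (l < k)%N)) /=.
rewrite [X in _ = _ + X](bigD1 k) ?fk ?ltnn //=.
rewrite [X in _ = _ + (_ + X)](eq_bigl (fun l => ferm l && (ferm k && (k < l)%N))); last first.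
  move=> l; rewrite fk -leqNgt /= -andbA; congr (_ && _).
  by rewrite [RHS]ltn_neqAle andbC eq_sym.
under eq_bigr do rewrite mulrC; rewrite fk /=; ring.
Qed.

Definition sgn (z : int) : K := (-1) ^ z.

Lemma sgnD z z' : sgn (z + z') = sgn z * sgn z'.
Proof. by rewrite /sgn expfzDr // oppr_eq0 oner_eq0. Qed.
Lemma sgn_neq0 z : sgn z != 0.
Proof. by rewrite /sgn expfz_neq0 // oppr_eq0 oner_eq0. Qed.
Lemma sgn_sq z : sgn z * sgn z = 1.
Proof. by rewrite -expfzMl mulrNN mulr1 exp1rz. Qed.
Lemma sgnN z : sgn (- z) = sgn z.
Proof. by rewrite /sgn -exprz_inv invrN1. Qed.
Lemma sgn_odd z : sgn z = if odd (absz z) then -1 else 1.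
Proof.
rewrite -[LHS](_ : sgn (absz z)%:Z = _); last first.
  by case: (lerP 0 z) => z0; [rewrite gez0_abs | rewrite ltz0_abs // sgnN].
by rewrite /sgn -exprnP -signr_odd; case: odd; rewrite ?expr1 ?expr0.
Qed.

(** In both coefficients [b] is the target weight. The sign of [coefY] is taken at its source
    [b + col i gam], so that it cancels the sign of [coefX] in [coefYX]. *)
Definition coefX i b : K :=
  sgn (fermi_form (col i gam) b) *
  \prod_k fac (ferm k) (gam k i) (uval K b k).
Definition coefY i b : K :=
  sgn (fermi_form (col i gam) (b + col i gam)) *
  \prod_k (fermion_sign K (ferm k) (gam k i)
           * fac (ferm k) (- gam k i) (uval K b k)).

Hypothesis gam_cond : gamma_cond gam.

Lemma gam_ferm j i : ferm j -> `|gam j i| <= 1.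
Proof. by case: gam_cond => H _; exact: H. Qed.

Lemma coefYX i b : coefY i b * coefX i (b + col i gam) = ev b (tt K gam i).
Proof.
rewrite /coefX /coefY mulrACA sgn_sq mul1r -big_split /=.
rewrite /tt ev_prod big_map big_enum /=; apply: eq_bigr => j _.
by rewrite ev_uji ?uval_add ?mxE //; apply: gam_ferm.
Qed.

(** The diagonal sum in [fermi_form_sym] vanishes, so the two forms add up to the product of the
    total fermionic degrees, which is odd exactly when [pbar i && pbar i']. *)
Lemma mu_sgn i i' : (forall k, ferm k -> gam k i * gam k i' = 0) ->
  mu K gam i i' =
  sgn (fermi_form (col i gam) (col i' gam) + fermi_form (col i' gam) (col i gam)).
Proof.
move=> disj; have := fermi_form_sym (col i gam) (col i' gam).
rewrite [X in _ + X]big1 ?addr0 => [->|k fk]; last by rewrite !mxE disj.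
rewrite sgn_odd abszM oddM /mu /pbar.
have E l : \sum_(k | ferm k) gam k l = \sum_(k | ferm k) col l gam k 0.
  by apply: eq_bigr => k _; rewrite mxE.
by rewrite !E.
Qed.

(** The two alternatives of condition (ii). If a fermionic row has entries of opposite signs, [X_i]
    and [Y_i'] make the same nonzero move there and both sides vanish by exclusion. Otherwise the
    Jordan-Wigner signs produce [mu] and the remaining factors commute. *)
Lemma coefXY_comm i i' b : i != i' ->
  coefX i b * coefY i' (b - col i gam)
  = mu K gam i i' * (coefY i' b * coefX i (b + col i' gam)).
Proof.
move=> ii'.
have [/existsP[k /andP[fk neg]]|/existsPn pos] :=
    boolP [exists k, ferm k && (gam k i * gam k i' < 0)].
  have z (d d' : int) (x : K) : `|d| <= 1 -> `|d'| <= 1 -> d * d' < 0 -> x * x = x ->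
      fac true d x * fac true (- d') (ushift true d x) = 0 :> K.
    move=> h h' dd' xx; have -> : - d' = d by nia.
    by apply: fac_fermion_sq => //; apply/eqP; nia.
  have h := gam_ferm i fk; have h' := gam_ferm i' fk.
  rewrite /coefX /coefY !(bigD1 (P := xpredT) k) //= fk uval_sub uval_add fk !mxE.
  have z1 := z _ _ _ h h' neg (uval_sq K b fk).
  have z2 : fac true (- gam k i') (uval K b k) *
      fac true (gam k i) (ushift true (- gam k i') (uval K b k)) = 0.
    by rewrite -{1}[gam k i]opprK; apply: z; rewrite ?normrN ?mulrNN 1?mulrC ?uval_sq.
  set A := fac _ _ _ in z1 *; set B := fac _ _ _ in z1 *.
  set C := fac _ _ _ in z2 *; set D := fac _ _ _ in z2 *.
  set sg := fermion_sign _ _ _.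
  set X1 := \prod_(_ | _) _; set X2 := \prod_(_ | _) _.
  set X3 := \prod_(_ | _) _; set X4 := \prod_(_ | _) _.
  by ring: z1 z2.
have le0 k : gam k i * gam k i' <= 0.
  case: gam_cond => _ /(_ _ _ ii')[[l [fl neg]]|]; last exact.
  by have := pos l; rewrite fl neg.
(* Outside the first case a fermionic product is neither negative nor, by [le0], positive. *)
have disj k : ferm k -> gam k i * gam k i' = 0.
  by move=> fk; have := pos k; have := le0 k; rewrite fk /=; lia.
rewrite mu_sgn // /coefX /coefY.
rewrite mulrACA [X in _ = _ * X]mulrACA [RHS]mulrA; congr (_ * _).
  rewrite !fermi_formDr fermi_formN !sgnD sgnN.
  set a := sgn _; set c := sgn _; set d := sgn (fermi_form _ (col i gam)).
  set e := sgn _; set x := sgn (fermi_form _ (col i' gam)).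
  have := sgn_sq (fermi_form (col i gam) (col i' gam)); rewrite -/x => xx.
  by ring: xx.
rewrite -!big_split /=.
apply: eq_bigr => k _; rewrite uval_sub uval_add !mxE.
(* [Y_i'] moves by [- gam k i'], so [gam k i * gam k i' <= 0] says that the two moves point weakly
   the same way. *)
rewrite mulrCA -[RHS]mulrA; congr (_ * _); apply: fac_comm.
  by move=> fk; rewrite normrN !gam_ferm.
by rewrite mulrN oppr_ge0.
Qed.

(* A weight together with a degree. *)
Local Notation state := ('cV[int]_n * 'cV[int]_m)%type.
Implicit Types (s : state) (phi : state -> K).

Definition step (l : letter) : state :=
  match l with
  | inl _ => 0
  | inr (inl i) => (col i gam, delta_mx i 0)
  | inr (inr i) => - (col i gam, delta_mx i 0)
  end.
Definition wstep w : state := \sum_(l <- w) step l.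
Definition lcoef (l : letter) s : K :=
  match l with
  | inl j => uval K s.1 j
  | inr (inl i) => coefX i s.1
  | inr (inr i) => coefY i s.1
  end.
(** Here [s] is the target: the leftmost letter acts last, so reading the word from the left walks
    back towards the source. *)
Fixpoint wcoef w s : K :=
  if w is l :: w' then lcoef l s * wcoef w' (s - step l) else 1.

Lemma wcoef_cat v w s : wcoef (v ++ w) s = wcoef v s * wcoef w (s - wstep v).
Proof.
elim: v s => [|l v IH] s /=; first by rewrite /wstep big_nil subr0 mul1r.
by rewrite IH mulrA /wstep big_cons opprD addrA.
Qed.

Lemma wstep_cat v w : wstep (v ++ w) = wstep v + wstep w.
Proof. exact: big_cat. Qed.

Lemma snd_sum (I : Type) (t : seq I) (F : I -> state) :
  (\sum_(x <- t) F x).2 = \sum_(x <- t) (F x).2.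
Proof. by elim/big_rec2: _ => // x y1 y2 _ <-. Qed.
Lemma wstep_deg w i : (wstep w).2 i 0 = deg w i.
Proof.
rewrite /wstep snd_sum summxE /deg; apply: eq_bigr => l _.
by case: l => [j|[k|k]]; rewrite /= !mxE // eqxx andbT eq_sym; case: eqP.
Qed.

Definition act f phi s : K := pairing f (fun w => wcoef w s * phi (s - wstep w)).

Lemma act_mul f g phi s : act (fmul f g) phi s = act f (act g phi) s.
Proof.
rewrite /act pairingE; apply: eq_pairing => w; rewrite -pairing_scalel.
by apply: eq_pairing => v; rewrite wcoef_cat wstep_cat opprD addrA mulrA.
Qed.

Lemma act_sub f g phi s : act (fsub f g) phi s = act f phi s - act g phi s.
Proof. exact: pairing_fsub. Qed.

Lemma act_scale c f phi s : act (fscale c f) phi s = c * act f phi s.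
Proof. exact: pairing_fscale. Qed.

Lemma act_mon w phi s : act (mon K w) phi s = wcoef w s * phi (s - wstep w).
Proof. exact: pairing_mon. Qed.

Lemma act_letter l phi s :
  act (fletter K l) phi s = lcoef l s * phi (s - step l).
Proof. by rewrite /act pairingE /= mulr1 /wstep big_seq1. Qed.

Lemma act_isR f phi s : isR f -> act f phi s = ev s.1 f * phi s.
Proof.
move=> Rf; rewrite /act /ev -pairing_scaler /pairing !big_seq; apply: eq_bigr => x xf.
congr (_ * _); move: (allP Rf _ xf); elim: x.2 s {xf} => [|l w IH] s /=.
  by rewrite /evw /wstep !big_nil subr0.
case: l => // j /= /IH {}IH; rewrite -mulrA.
by rewrite /wstep big_cons add0r /= subr0 IH /evw big_cons mulrA.
Qed.

(** The annihilator of the Fock module, which serves below as an admissible ideal. *)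
Definition vanishing f : Prop := forall phi s, act f phi s = 0.

Lemma vanishing_ideal : ideal vanishing.
Proof.
split=> [f g /feq_pairing fg vf phi s||f g vf vg phi s|f a b vf phi s].
- by rewrite /act -fg; exact: vf.
- by move=> phi s; exact: pairing_nil.
- by rewrite /act pairing_fadd -!/(act _ _ _) vf vg addr0.
rewrite !act_mul.
suff: pairing a (fun=> 0) = 0 by apply: etrans; apply: eq_pairing => w; rewrite vf mulr0.
by rewrite /pairing big1 // => x _; rewrite mulr0.
Qed.

(** Cutting [phi] off outside the degree [s.2 - h] retains exactly the words of degree [g]. This is
    the purpose of recording the degree in a state. *)
Lemma vanishing_graded : graded vanishing.
Proof.
move=> f g vf phi s; pose h : 'cV[int]_m := \col_i g i.
have := vf (fun t => phi t * (t.2 == s.2 - h)%:R) s; apply: etrans.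
rewrite /act /pairing /component big_filter big_mkcond /=; apply: eq_bigr => x _.
suff -> : [forall i, deg x.2 i == g i] = ((s - wstep x.2).2 == s.2 - h).
  by case: eqP => _; rewrite ?mulr1 // !mulr0.
rewrite /= (inj_eq (addrI _)) (inj_eq oppr_inj); apply/forallP/eqP => [e|e i].
  by apply/matrixP => i j; rewrite ord1 wstep_deg (eqP (e i)) mxE.
by rewrite -wstep_deg e mxE.
Qed.

Lemma Rel_vanishing f : Rel gam f -> vanishing f.
Proof.
move=> H phi s; case: H => [[a [b ->]]|].
  rewrite act_isR; first by rewrite !evE; ring.
  by rewrite isR_fsub.
case=> [[j [fj ->]]|].
  rewrite act_isR; first by rewrite !evE uval_sq // subrr mul0r.
  by rewrite isR_fsub.
case=> [[i [r [Rr ->]]]|].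
  rewrite act_sub !act_mul act_letter (act_isR _ _ (isR_sigma _ _ Rr)).
  by rewrite act_letter (act_isR _ _ Rr) ev_sigma /=; ring.
case=> [[i [r [Rr ->]]]|].
  rewrite act_sub !act_mul act_letter (act_isR _ _ (isR_sigmainv _ _ Rr)).
  by rewrite act_letter (act_isR _ _ Rr) ev_sigmainv /= opprK; ring.
case=> [[i ->]|].
  rewrite act_sub !act_mul !act_letter (act_isR _ _ (isR_tt _ _ _)).
  by rewrite -coefYX /= !opprK addrK; ring.
case=> [[i ->]|].
  rewrite act_sub !act_mul !act_letter (act_isR _ _ (isR_sigma _ _ (isR_tt _ _ _))).
  by rewrite ev_sigma -coefYX /= opprK !subrK; ring.
case=> i [i' [ii' ->]].
rewrite act_sub act_scale !act_mul !act_letter /= !opprK mulrA coefXY_comm //.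
by rewrite addrAC; ring.
Qed.

Lemma Krel_vanishing f : Krel gam f -> vanishing f.
Proof. by apply; [exact: vanishing_ideal|exact: Rel_vanishing]. Qed.

End FockModule.

(** * Normal forms modulo the relations *)

Section Presentation.
Variable K : fieldType.
Variables p q m : nat.
Local Notation n := (p + q)%N.
Local Notation word := (word p q m).
Local Notation letter := (letter p q m).
Local Notation fsum := (fsum K p q m).
Variable gam : 'M[int]_(n, m).
Implicit Types (f g h r : fsum) (u v w : word) (i : 'I_m).
Local Notation Krel := (@Krel K p q m gam).
Local Notation one := (fone K p q m).
Local Notation mon := (@mon K p q m).

Lemma Krel_ideal : ideal Krel.
Proof.
split=> [f g fg Kf|P [_ P0 _ _] _ //|f g Kf Kg|f a b Kf] P idP RP.
- by case: (idP) => H _ _ _; apply: H fg _; apply: Kf.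
- by case: (idP) => _ _ H _; apply: H; [apply: Kf|apply: Kg].
- by case: (idP) => _ _ _ H; apply: H; apply: Kf.
Qed.

Lemma Krel_Rel f : Rel gam f -> Krel f.
Proof. by move=> Rf P _; exact. Qed.

Definition keq f g : Prop := Krel (fsub f g).

Lemma feq_keq f g : feq f g -> keq f g.
Proof.
move=> /feq_pairing fg; apply: (ideal_feq Krel_ideal _ (ideal0 Krel_ideal)).
by apply/feq_pairing => F; rewrite !pairingE fg subrr.
Qed.

Lemma keq_refl f : keq f f.
Proof. exact: feq_keq. Qed.
#[local] Hint Resolve keq_refl : core.

#[local] Instance keq_equiv : Equivalence keq.
Proof.
split=> [f|f g fg|f g h fg gh]; first exact: keq_refl.
  apply: (ideal_feq Krel_ideal _ (idealZ Krel_ideal (-1) fg)).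
  by apply/feq_pairing => F; rewrite !pairingE; ring.
apply: (ideal_feq Krel_ideal _ (idealD Krel_ideal fg gh)).
by apply/feq_pairing => F; rewrite !pairingE; ring.
Qed.

#[local] Instance feq_keq_sub : subrelation (@feq K p q m) keq.
Proof. exact: feq_keq. Qed.

#[local] Instance fmul_keq : Proper (keq ==> keq ==> keq) (@fmul K p q m).
Proof.
move=> f f' ff' g g' gg'; transitivity (fmul f' g).
  apply: (ideal_feq Krel_ideal _ (fidealMr Krel_ideal g ff')). 
  by apply/feq_pairing => F; rewrite !pairingE.
apply: (ideal_feq Krel_ideal _ (fidealMl Krel_ideal f' gg')).
apply/feq_pairing => F; rewrite !pairingE -pairing_sub; apply: eq_pairing => w.
by rewrite !pairingE.
Qed.

#[local] Instance fadd_keq : Proper (keq ==> keq ==> keq) (@fadd K p q m).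
Proof.
move=> f f' ff' g g' gg'.
apply: (ideal_feq Krel_ideal _ (idealD Krel_ideal ff' gg')).
by apply/feq_pairing => F; rewrite !pairingE; ring.
Qed.

#[local] Instance fscale_keq c : Proper (keq ==> keq) (@fscale K p q m c).
Proof.
move=> f f' ff'; apply: (ideal_feq Krel_ideal _ (idealZ Krel_ideal c ff')).
by apply/feq_pairing => F; rewrite !pairingE; ring.
Qed.

Lemma keq_Krel f g : keq f g -> Krel g -> Krel f.
Proof.
move=> fg Kg; apply: (ideal_feq Krel_ideal _ (idealD Krel_ideal fg Kg)).
by apply/feq_pairing => F; rewrite !pairingE; ring.
Qed.

Lemma keq_map f (T : word -> word) :
  (forall x, x \in f -> keq (mon x.2) (mon (T x.2))) ->
  keq f [seq (x.1, T x.2) | x <- f].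
Proof.
elim: f => [|[c w] f IH] H; first reflexivity.
transitivity (fadd (fscale c (mon w)) f).
  by apply: feq_keq; apply/feq_pairing => F; rewrite !pairingE pairing_cons.
transitivity (fadd (fscale c (mon (T w))) [seq (x.1, T x.2) | x <- f]).
  apply: fadd_keq; first by apply: fscale_keq; exact: (H (c, w) (mem_head _ _)).
  by apply: IH => x xf; apply: H; rewrite inE xf orbT.
by apply: feq_keq; apply/feq_pairing => F; rewrite !pairingE pairing_cons.
Qed.

Lemma keq_mon_cat u u' v v' : keq (mon u) (mon u') -> keq (mon v) (mon v') ->
  keq (mon (u ++ v)) (mon (u' ++ v')).
Proof. by move=> e e'; rewrite !mon_cat e e'; reflexivity. Qed.

Lemma keq_trans f g h : keq f g -> keq g h -> keq f h.
Proof. by move=> fg gh; transitivity g. Qed.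

Lemma keq_uu (j k : 'I_n) : keq (mon [:: inl j; inl k]) (mon [:: inl k; inl j]).
Proof.
apply: (ideal_feq Krel_ideal _ (Krel_Rel (or_introl _ _))); last by exists j, k.
by apply/feq_pairing => F; rewrite !pairingE.
Qed.

Lemma keq_idem (j : 'I_n) : (p <= j)%N ->
  keq (mon [:: inl j; inl j]) (mon [:: inl j]).
Proof.
move=> fj; apply: (ideal_feq Krel_ideal _ (Krel_Rel _)); last first.
  by right; left; exists j; split.
by apply/feq_pairing => F; rewrite !pairingE.
Qed.

Lemma keq_uC (j : 'I_n) w : all (@is_u p q m) w ->
  keq (mon (inl j :: w)) (mon (w ++ [:: inl j])).
Proof.
elim: w => [|[k|//] w IH] /= aw; first reflexivity.
transitivity (mon (inl k :: inl j :: w)).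
  exact: (@keq_mon_cat [:: _; _] [:: _; _] w w (keq_uu j k)).
by apply: (@keq_mon_cat [:: _] [:: _]); [reflexivity|exact: IH].
Qed.

Lemma keq_fUC j r : isR r -> keq (fmul (fU K m j) r) (fmul r (fU K m j)).
Proof.
elim: r => [|[c w] r IH] /=.
  by move=> _; apply: feq_keq; apply/feq_pairing => F; rewrite !pairingE.
case/andP=> aw /IH {}IH.
have E : feq ((c, w) :: r) (fadd (fscale c (mon w)) r).
  by apply/feq_pairing => F; rewrite !pairingE pairing_cons.
rewrite E.
transitivity (fadd (fscale c (mon (inl j :: w))) (fmul (fU K m j) r)).
  by apply: feq_keq; apply/feq_pairing => F; rewrite !pairingE.
rewrite (keq_uC j aw) IH.
by apply: feq_keq; apply/feq_pairing => F; rewrite !pairingE.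
Qed.

Lemma keq_fX i r : isR r -> keq (fmul (fX K p q i) r) (fmul (sigma gam i r) (fX K p q i)).
Proof. by move=> Rr; apply: Krel_Rel; do 2 right; left; exists i, r. Qed.

Lemma keq_fY i r : isR r -> keq (fmul (fY K p q i) r) (fmul (sigmainv gam i r) (fY K p q i)).
Proof. by move=> Rr; apply: Krel_Rel; do 3 right; left; exists i, r. Qed.

(* The factor [r] may be zero; what matters is that it acts diagonally. *)
Definition red w w' : Prop := exists r, isR r /\ keq (mon w) (fmul r (mon w')).

Lemma red_refl w : red w w.
Proof. by exists one; split => //; rewrite fmul1f; reflexivity. Qed.

Lemma red_trans v u w : red u v -> red v w -> red u w.
Proof.
case=> r [Rr e] [r' [Rr' e']]; exists (fmul r r'); split; first exact: isR_fmul.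
by rewrite e e' fmulA; reflexivity.
Qed.

Lemma red_catr v w w' : red w w' -> red (w ++ v) (w' ++ v).
Proof.
by case=> r [Rr e]; exists r; split; rewrite // !mon_cat e fmulA; reflexivity.
Qed.

(** The letter is carried past the factor from [R]: a [u_j] commutes with it, while [X_i] and [Y_i]
    twist it by [sigma] and [sigmainv]. *)
Lemma red_cons l w w' : red w w' -> red (l :: w) (l :: w').
Proof.
case=> r [Rr e].
suff [r' [Rr' e']] : exists r', isR r' /\
    keq (fmul (mon [:: l]) r) (fmul r' (mon [:: l])).
  exists r'; split => //.
  by rewrite mon_cons (mon_cons K l w') e fmulA e' -fmulA; reflexivity.
case: l => [j|[i|i]].
- by exists r; split; last exact: keq_fUC.
- by exists (sigma gam i r); split; [exact: isR_sigma|exact: keq_fX].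
- by exists (sigmainv gam i r); split; [exact: isR_sigmainv|exact: keq_fY].
Qed.

Lemma red_catl v w w' : red w w' -> red (v ++ w) (v ++ w').
Proof. by move=> ww'; elim: v => //= l v; exact: red_cons. Qed.

Definition X i : letter := inr (inl i).
Definition Y i : letter := inr (inr i).
Implicit Types (xs ys : seq 'I_m).

Lemma red_u (j : 'I_n) : red [:: inl j] [::].
Proof. by exists (fU K m j); split => //; rewrite fmulf1; reflexivity. Qed.

Lemma red_XY i : red [:: X i; Y i] [::].
Proof.
exists (sigma gam i (tt K gam i)); split; first by apply: isR_sigma; exact: isR_tt.
rewrite fmulf1; apply: (ideal_feq Krel_ideal _ (Krel_Rel _)); last first.
  by do 5 right; left; exists i.
by apply/feq_pairing => F; rewrite !pairingE.
Qed.

Lemma red_YX i : red [:: Y i; X i] [::].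
Proof.
exists (tt K gam i); split; first exact: isR_tt.
rewrite fmulf1; apply: (ideal_feq Krel_ideal _ (Krel_Rel _)); last first.
  by do 4 right; left; exists i.
by apply/feq_pairing => F; rewrite !pairingE.
Qed.

Lemma keq_XY i k : i != k ->
  keq (mon [:: X i; Y k]) (fscale (mu K gam i k) (mon [:: Y k; X i])).
Proof.
move=> ik; apply: (ideal_feq Krel_ideal _ (Krel_Rel _)); last first.
  by do 6 right; exists i, k.
by apply/feq_pairing => F; rewrite !pairingE.
Qed.

Lemma red_XY_swap i k : i != k -> red [:: X i; Y k] [:: Y k; X i].
Proof.
move=> ik; exists (fconst p q m (mu K gam i k)); split => //.
by rewrite (keq_XY ik); apply: feq_keq; apply/feq_pairing => F; rewrite !pairingE.
Qed.

(** The scalar [mu] is its own inverse, being 1 or -1. *)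
Lemma red_YX_swap i k : i != k -> red [:: Y k; X i] [:: X i; Y k].
Proof.
move=> ik; exists (fconst p q m (mu K gam i k)); split => //.
transitivity (fscale (mu K gam i k) (mon [:: X i; Y k])); last first.
  by apply: feq_keq; apply/feq_pairing => F; rewrite !pairingE.
rewrite (keq_XY ik); apply: feq_keq; apply/feq_pairing => F; rewrite !pairingE mulrA.
by rewrite /mu; case: ifP; rewrite ?mulrNN !mul1r.
Qed.

Lemma red_X_Ys i ys : i \notin ys ->
  red (X i :: map Y ys) (map Y ys ++ [:: X i]).
Proof.
elim: ys => [|k ys IH] /=; first by move=> _; exact: red_refl.
rewrite inE negb_or => /andP[ik /IH {}IH].
apply: (@red_trans [:: Y k, X i & map Y ys]); last exact: red_cons.
exact: (@red_catr (map Y ys) [:: _; _] [:: _; _] (red_XY_swap ik)).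
Qed.

Lemma red_Ys_X i ys : i \notin ys ->
  red (map Y ys ++ [:: X i]) (X i :: map Y ys).
Proof.
elim: ys => [|k ys IH] /=; first by move=> _; exact: red_refl.
rewrite inE negb_or => /andP[ik /IH {}IH].
apply: (@red_trans [:: Y k, X i & map Y ys]); first exact: red_cons.
exact: (@red_catr (map Y ys) [:: _; _] [:: _; _] (red_YX_swap ik)).
Qed.

Lemma red_Y_Xs i xs : i \notin xs ->
  red (Y i :: map X xs) (map X xs ++ [:: Y i]).
Proof.
elim: xs => [|k xs IH] /=; first by move=> _; exact: red_refl.
rewrite inE negb_or eq_sym => /andP[ik /IH {}IH].
apply: (@red_trans [:: X k, Y i & map X xs]); last exact: red_cons.
exact: (@red_catr (map X xs) [:: _; _] [:: _; _] (red_YX_swap ik)).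
Qed.

Lemma red_Xs_Ys xs ys : {in xs, forall i, i \notin ys} ->
  red (map X xs ++ map Y ys) (map Y ys ++ map X xs).
Proof.
elim: xs => [|i xs IH] H /=; first by rewrite cats0; exact: red_refl.
apply: (@red_trans (X i :: map Y ys ++ map X xs)).
  by apply: red_cons; apply: IH => k kx; apply: H; rewrite inE kx orbT.
rewrite -cat_cons -[X i :: map X xs]cat1s catA; apply: red_catr.
by apply: red_X_Ys; apply: H; exact: mem_head.
Qed.

Lemma red_Ys_Xs xs ys : {in xs, forall i, i \notin ys} ->
  red (map Y ys ++ map X xs) (map X xs ++ map Y ys).
Proof.
elim: xs => [|i xs IH] H /=; first by rewrite cats0; exact: red_refl.
apply: (@red_trans (X i :: map Y ys ++ map X xs)); last first.
  by apply: red_cons; apply: IH => k kx; apply: H; rewrite inE kx orbT.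
rewrite -cat_cons -[X i :: map X xs]cat1s catA; apply: red_catr.
by apply: red_Ys_X; apply: H; exact: mem_head.
Qed.

Lemma first_occurrence (T : eqType) (x : T) (t : seq T) : x \in t ->
  exists t1 t2, t = t1 ++ x :: t2 /\ x \notin t1.
Proof.
elim: t => // y t IH; rewrite inE; have [->|xy /= /IH] := eqVneq x y.
  by exists [::], t.
case=> t1 [t2 [-> xt1]]; exists (y :: t1), t2.
by rewrite inE negb_or xy.
Qed.

(** Letters are added on the left one at a time. A [u_j] is absorbed into [R]; an [X_k] or [Y_k]
    joins its block, unless the opposite letter with the same index is present, in which case the
    two are brought together and cancel into [R]. *)
Lemma normal_form w : exists xs ys,
  [/\ {in xs, forall i, i \notin ys}, red w (map Y ys ++ map X xs) &
      forall i, deg w i = (count_mem i xs)%:Z - (count_mem i ys)%:Z].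
Proof.
elim: w => [|l w [xs [ys [disj rw dw]]]].
  by exists [::], [::]; split=> //; [exact: red_refl | move=> i; rewrite /deg big_nil].
have rlw := red_cons l rw.
have dlw i : deg (l :: w) i = ldeg l i + deg w i by rewrite /deg big_cons.
case: l rlw dlw => [j|[k|k]] rlw dlw.
- exists xs, ys; split=> // [|i]; last by rewrite dlw add0r dw.
  apply: red_trans rlw _; exact: (@red_catr _ [:: _] [::] (red_u j)).
- have [kys|kys] := boolP (k \in ys); last first.
    exists (k :: xs), ys; split.
    + by move=> i; rewrite inE => /predU1P[->|/disj].
    + apply: red_trans rlw _; rewrite -cat_cons -[map X (_ :: _)]cat1s catA.
      by apply: red_catr; apply: red_X_Ys.
    + by move=> i; rewrite dlw dw /= PoszD addrA.
  (* Choosing the first [Y_k] lets [X_k] pass everything before it. *)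
  have [y1 [y2 [eys ky1]]] := first_occurrence kys; subst ys.
  have kxs : k \notin xs by apply: contraL kys => /disj.
  exists xs, (y1 ++ y2); split.
  + move=> i /disj; rewrite !mem_cat inE !negb_or.
    by case/and3P => -> _ ->.
  + apply: red_trans rlw _; rewrite !map_cat -!catA /=.
    rewrite -[_ :: _ ++ _]/((X k :: map Y y1) ++ _).
    apply: (@red_trans ((map Y y1 ++ [:: X k]) ++ Y k :: map Y y2 ++ map X xs)).
      by apply: red_catr; exact: red_X_Ys.
    rewrite -catA; apply: red_catl; exact: (@red_catr _ [:: _; _] [::] (red_XY k)).
  + move=> i; rewrite dlw dw !count_cat /= !PoszD; case: eqP => _ /=; lia.
- have [kxs|kxs] := boolP (k \in xs); last first.
    exists xs, (k :: ys); split => //.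
    + move=> i ix; rewrite inE negb_or disj // andbT.
      by apply: contraNneq kxs => <-.
    + by move=> i; rewrite dlw dw /= PoszD; case: eqP => _ /=; lia.
  have [x1 [x2 [exs kx1]]] := first_occurrence kxs; subst xs.
  have kys : k \notin ys by exact: disj.
  have disj1 : {in x1, forall i, i \notin ys}.
    by move=> i ix; apply: disj; rewrite mem_cat ix.
  exists (x1 ++ x2), ys; split.
  + move=> i; rewrite mem_cat => ix; apply: disj.
    by rewrite mem_cat inE; case/orP: ix => ->; rewrite ?orbT.
  + apply: red_trans rlw _; rewrite !map_cat /=.
    (* The partner [X_k] lies behind both [ys] and [x1]. So [x1] is moved to the front, [Y_k] passes
       it, [X_k] passes [ys] to meet [Y_k], and after the cancellation [ys] returns to the front. *)
    apply: (@red_trans (Y k :: (map X x1 ++ map Y ys) ++ X k :: map X x2)).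
      by apply: red_cons; rewrite catA; apply: red_catr; exact: red_Ys_Xs.
    rewrite -!catA -[_ :: _ ++ _]/((Y k :: map X x1) ++ _).
    apply: (@red_trans ((map X x1 ++ [:: Y k]) ++ map Y ys ++ X k :: map X x2)).
      by apply: red_catr; exact: red_Y_Xs.
    apply: (@red_trans (map X x1 ++ map Y ys ++ map X x2)); last first.
      by rewrite !catA; apply: red_catr; exact: red_Xs_Ys.
    rewrite -catA; apply: red_catl => /=.
    apply: (@red_trans (Y k :: X k :: map Y ys ++ map X x2)); last first.
      exact: (@red_catr _ [:: _; _] [::] (red_YX k)).
    apply: red_cons; rewrite -[X k :: map X x2]cat1s -cat_cons catA.
    by apply: red_catr; exact: red_Ys_X.
  + move=> i; rewrite dlw dw !count_cat /= !PoszD; case: eqP => _ /=; lia.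
Qed.

End Presentation.

(** * Alternating rows and faithfulness *)

Section Alternation.
Implicit Types (x y : bool) (d : int) (t : seq int).

(* [x] is the parity of the target weight of the move [d]. *)
Definition legal d x : bool := ((d == 1) ==> ~~ x) && ((d == -1) ==> x).

Fixpoint alternating x t : bool :=
  if t is d :: t' then legal d x && alternating (x (+) odd (absz d)) t' else true.

Lemma alternating_drop k x t :
  alternating x t -> exists y, alternating y (drop k t).
Proof.
elim: k x t => [|k IH] x [|d t] /=; try by move=> H; exists x.
by case/andP=> _ /IH.
Qed.

Lemma alternating_drop0 k x t : (forall l, (l < k)%N -> nth 0 t l = 0) ->
  alternating x (drop k t) = alternating x t.
Proof.
elim: k t => [|k IH] [|d t] //= H.
have -> : d = 0 by exact: (H 0%N).
by rewrite /legal /= addbF IH // => l; exact: (H l.+1).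
Qed.

(** A nonzero legal move flips the parity and zeros preserve it, so an equal move coming next would
    be illegal. *)
Lemma alternating_no_block x t : alternating x t -> ~ has_bad_block t.
Proof.
move=> alt [k [l [/andP[kl lt] [ends zeros]]]].
have [y] := alternating_drop k alt.
rewrite (drop_nth 0) ?(ltn_trans kl) //=; case/andP=> leg.
rewrite -(@alternating_drop0 (l - k.+1)); last first.
  by move=> i ik; rewrite nth_drop zeros //; lia.
rewrite drop_drop subnK // (drop_nth 0) //= => /andP[leg' _].
by move: leg leg'; case: ends => -[-> ->]; case: y.
Qed.

(** A nonzero head forces the initial parity. Without a bad block the next nonzero entry is its
    opposite, and this forces the tail to start from exactly the flipped parity. *)
Lemma no_block_alternating t : {in t, forall d, `|d| <= 1} ->
  ~ has_bad_block t -> exists x, alternating x t.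
Proof.
elim: t => [|d t IH] le1 nb; first by exists true.
have [||y alt] := IH.
- by move=> e et; apply: le1; rewrite inE et orbT.
- move=> [k [l [kl [ends zeros]]]]; apply: nb; exists k.+1, l.+1.
  by split=> //; split=> // -[|i] //; exact: zeros.
have [d0|d0] := eqVneq d 0.
  by exists y; rewrite /= d0 /legal /= addbF.
have d1 : `|d| <= 1 by apply: le1; exact: mem_head.
exists (d == -1); rewrite /=.
have -> : legal d (d == -1) by rewrite /legal; lia.
have -> : (d == -1) (+) odd `|d| = (d == 1).
  have -> : odd `|d| by have -> : `|d|%N = 1%N by lia.
  by lia.
(* The next nonzero entry. If there is none, the tail is alternating from any parity. *)
pose l := find (fun e => e != 0) t.
have zeros i : (i < l)%N -> nth 0 t i = 0.
  by move=> /(before_find 0) /negbFE /eqP.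
rewrite -(@alternating_drop0 l) //; move: alt; rewrite -(@alternating_drop0 l) //.
have [hs|] := boolP (has (fun e => e != 0) t); last first.
  by move=> hs; rewrite drop_oversize // leqNgt -has_find.
have lt : (l < size t)%N by rewrite -has_find.
have e0 := nth_find 0 hs; rewrite -/l /= in e0.
have e1 : `|nth 0 t l| <= 1 by apply: le1; rewrite inE mem_nth ?orbT.
have ed : nth 0 t l != d.
  apply/eqP => ed; apply: nb; exists 0%N, l.+1; split; first by rewrite /= ltnS.
  split=> [|[|i] //]; last exact: zeros.
  have [dE|dE] : d = 1 \/ d = -1 by lia.
    by left; rewrite /= ed dE.
  by right; rewrite /= ed dE.
rewrite (drop_nth 0 lt) /= => /andP[leg alt].
suff <- : y = (d == 1) by rewrite leg alt.
clear alt; move: (nth 0 t l) e0 e1 ed leg => e e0 e1 ed.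
by rewrite /legal; case: (y); lia.
Qed.

End Alternation.

(** * Characteristic zero: nonvanishing coefficients, reversed words and faithfulness of [R] *)

Section GradedPieces.
Variable K : fieldType.
Hypothesis char0 : [pchar K] =i pred0.
Variables p q m : nat.
Local Notation n := (p + q)%N.
Local Notation word := (word p q m).
Local Notation letter := (letter p q m).
Local Notation fsum := (fsum K p q m).
Variable gam : 'M[int]_(n, m).
Hypothesis gam_cond : gamma_cond gam.
Local Notation ferm k := (p <= (k : 'I_n))%N.
Local Notation state := ('cV[int]_n * 'cV[int]_m)%type.
Local Notation Krel := (@Krel K p q m gam).
Implicit Types (f h r : fsum) (u v w : word) (i : 'I_m) (b : 'cV[int]_n)
  (j k : 'I_n) (s : state).

Lemma natr_eq0 (a : nat) : (a%:R == 0 :> K) = (a == 0%N).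
Proof. by have /pcharf0P := char0. Qed.

Lemma intr_eq0 (z : int) : (z%:~R == 0 :> K) = (z == 0).
Proof.
case: z => a; first by rewrite -pmulrn natr_eq0.
by rewrite NegzE mulrNz oppr_eq0 -pmulrn natr_eq0.
Qed.

Lemma two_neq0 : 2 != 0 :> K. Proof. by rewrite natr_eq0. Qed.

(** It is half of the odd integer [2 z + 1], which is nonzero in characteristic 0. *)
Lemma half_int_neq0 (z : int) : z%:~R + 2^-1 != 0 :> K.
Proof.
have n2 := two_neq0.
have -> : z%:~R + 2^-1 = (2 * z + 1)%:~R / 2 :> K.
  by rewrite rmorphD rmorphM /=; field.
by rewrite mulf_neq0 ?invr_eq0 // intr_eq0; lia.
Qed.

Lemma fac_boson_neq0 (d : int) b k : ~~ ferm k ->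
  fac false d (uval K b k) != 0.
Proof.
move=> fk; rewrite /fac /uval (negbTE fk); case: ifP => _; first exact: oner_neq0.
apply/prodf_neq0 => l _; rewrite addrAC.
have -> : (b k 0)%:~R + l%:R = (b k 0 + (l : nat)%:Z)%:~R :> K by rewrite rmorphD.
exact: half_int_neq0.
Qed.

Lemma fac_fermion_neq0 (d : int) b k : ferm k -> `|d| <= 1 ->
  (fac true d (uval K b k) != 0) = legal d (odd (absz (b k 0))).
Proof.
move=> fk d1; rewrite /fac /uval fk /legal.
have [->|[->|->]] : d = 0 \/ d = 1 \/ d = -1 by lia.
- by rewrite oner_neq0.
- by case: odd; rewrite /= ?subrr ?subr0 ?oner_neq0 ?eqxx.
- by case: odd; rewrite /= ?oner_neq0 ?eqxx.
Qed.

Lemma fermion_sign_neq0 e d : fermion_sign K e d != 0.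
Proof. by rewrite /fermion_sign; case: ifP; rewrite ?oppr_eq0 oner_neq0. Qed.

(** Signs and bosonic factors never vanish, so only the parities of the fermionic coordinates
    matter. *)
Lemma lcoef_neq0 (l : letter) s : ~~ is_u l ->
  (lcoef K gam l s != 0) =
  [forall k, ferm k ==> legal ((step gam l).1 k 0) (odd (absz (s.1 k 0)))].
Proof.
have prodE (P : 'I_n -> K) : (\prod_k P k != 0) = [forall k, P k != 0].
  by apply/prodf_neq0/forallP => H k; [exact: H|move=> _; exact: H].
have facE k d : (ferm k -> `|d| <= 1) -> (fac (ferm k) d (uval K s.1 k) != 0)
    = (ferm k ==> legal d (odd (absz (s.1 k 0)))).
  move=> d1; case: (boolP (ferm k)) d1 => [fk /(_ isT) d1|fk _].
    by rewrite fac_fermion_neq0.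
  by rewrite fac_boson_neq0.
case: l => [//|[i|i]] _ /=; rewrite mulf_eq0 (negbTE (sgn_neq0 _ _)) /= prodE;
  apply: eq_forallb => k.
- by rewrite facE ?mxE // => fk; exact: gam_ferm.
rewrite mulf_eq0 (negbTE (fermion_sign_neq0 _ _)) /= facE ?mxE // normrN => fk.
exact: gam_ferm.
Qed.

Definition row_steps k w : seq int := [seq (step gam l).1 k 0 | l <- w].

Lemma wcoef_neq0 w s : all (fun l => ~~ is_u l) w ->
  (wcoef K gam w s != 0) =
  [forall k, ferm k ==> alternating (odd (absz (s.1 k 0))) (row_steps k w)].
Proof.
elim: w s => [|l w IH] s /=.
  by move=> _; rewrite oner_neq0; symmetry; apply/forallP => k; rewrite implybT.
case/andP=> ul uw; rewrite mulf_eq0 negb_or lcoef_neq0 // IH //.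
have E k : odd (absz ((s - step gam l).1 k 0)) =
    odd (absz (s.1 k 0)) (+) odd (absz ((step gam l).1 k 0)).
  by rewrite /= !mxE odd_absz_sub.
apply/andP/forallP => [[/forallP H1 /forallP H2] k|H].
  by have := H1 k; have := H2 k; rewrite E; case: (ferm k) => //= -> ->.
split; apply/forallP => k; have := H k; rewrite ?E;
  by case: (ferm k) => //= /andP[].
Qed.

Definition invl (l : letter) : letter :=
  match l with
  | inl j => inl j
  | inr (inl i) => inr (inr i)
  | inr (inr i) => inr (inl i)
  end.

Definition invw w : word := rev (map invl w).

Lemma step_invl l : step gam (invl l) = - step gam l.
Proof. by case: l => [j|[i|i]] /=; rewrite ?oppr0 ?opprK. Qed.

Lemma wstep_invw w : wstep gam (invw w) = - wstep gam w.
Proof.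
rewrite /wstep /invw (perm_big (map invl w)) ?perm_rev //= big_map -sumrN.
by apply: eq_bigr => l _; exact: step_invl.
Qed.

(** A legal fermionic move flips the parity, and the flipped parity is the one that makes the
    opposite move legal. *)
Lemma lcoef_invl l s : ~~ is_u l -> lcoef K gam l s != 0 ->
  lcoef K gam (invl l) (s - step gam l) != 0.
Proof.
move=> ul; rewrite lcoef_neq0 // lcoef_neq0; last by case: l ul => [|[]].
move=> /forallP H; apply/forallP => k; apply/implyP => fk.
have := implyP (H k) fk; rewrite step_invl /= !mxE.
have le1 : `|(step gam l).1 k 0| <= 1.
  by case: l {H} ul => [//|[i|i]] _ /=; rewrite !mxE ?normrN; exact: gam_ferm.
rewrite /legal; move: (s.1 k 0) ((step gam l).1 k 0) le1 => x d d1.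
have [->|[->|->]] : d = 0 \/ d = 1 \/ d = -1 by lia.
- by rewrite subr0.
- lia.
- lia.
Qed.

(** The reversed word retraces the same path of weights, undoing one legal move at a time. *)
Lemma wcoef_invw w s : all (fun l => ~~ is_u l) w -> wcoef K gam w s != 0 ->
  wcoef K gam (invw w) (s - wstep gam w) != 0.
Proof.
elim: w s => [|l w IH] s //= /andP[ul uw]; rewrite mulf_eq0 negb_or.
case/andP=> nl /(IH _ uw) nw.
rewrite /invw /= rev_cons -cats1 wcoef_cat -/(invw w) /= mulr1 wstep_invw opprK.
rewrite [wstep gam (l :: w)]big_cons -/(wstep gam w) opprD addrA.
by rewrite subrK mulf_neq0 // lcoef_invl.
Qed.

Lemma evw_filter b j w : evw K b w =
  evw K b [seq l <- w | l != inl j] * uval K b j ^+ count_mem (inl j) w.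
Proof.
elim: w => [|l w IH]; first by rewrite /evw /= big_nil mulr1.
rewrite /evw big_cons -/(evw K b w) IH /=; case: eqP => [->|_] /=.
  by rewrite add1n exprS mulrCA.
by rewrite big_cons add0n mulrA.
Qed.

(** The exponent of [u_j] modulo the relations: for a fermion [u_j] is idempotent, so positive
    powers collapse to the first. *)
Definition u_exp j w : nat :=
  let c := count_mem (inl j) w in if ferm j then minn c 1 else c.

Lemma evw_u_exp b j w : evw K b w =
  evw K b [seq l <- w | l != inl j] * uval K b j ^+ u_exp j w.
Proof.
rewrite (evw_filter b j) /u_exp; case: ifP => // fj; congr (_ * _).
case: (count_mem _ _) => // c; rewrite (minn_idPr _) // expr1.
elim: c => [|c IH]; first by rewrite expr1.
by rewrite exprS IH uval_sq.
Qed.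

Lemma keq_u_exp j w : all (@is_u p q m) w ->
  keq gam (mon K w) (mon K ([seq l <- w | l != inl j] ++ nseq (u_exp j w) (inl j))).
Proof.
elim: w => [|l w IH] /=.
  by rewrite /u_exp /= min0n; case: ifP => _ _; exact: keq_refl.
case/andP=> ul uw; have {IH} := IH uw.
have cons_keq l' v v' : keq gam (mon K v) (mon K v') ->
    keq gam (mon K (l' :: v)) (mon K (l' :: v')).
  by move=> e; apply: (@keq_mon_cat _ _ _ _ _ [:: l'] [:: l']); [exact: keq_refl|].
move/(cons_keq l); case: (eqVneq l (inl j)) => [->|nl] /= e; last first.
  by rewrite /u_exp /= (negbTE nl) add0n.
apply: keq_trans e _; rewrite -cat_cons.
set v := filter _ _.
apply: (@keq_trans _ _ _ _ _ _ (mon K ((v ++ [:: inl j]) ++ nseq (u_exp j w) (inl j)))).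
  apply: keq_mon_cat; last exact: keq_refl.
  by apply: keq_uC; rewrite all_filter; by apply: sub_all uw => x /= ->; rewrite implybT.
rewrite -catA; apply: keq_mon_cat; first exact: keq_refl.
rewrite /u_exp /= eqxx add1n; case: ifP => [fj|_]; last exact: keq_refl.
case: (count_mem _ _) => [|c]; first exact: keq_refl.
by rewrite !(minn_idPr _) //=; exact: keq_idem.
Qed.

(** The eigenvalue of [u_j] at a weight with [j]-th coordinate [a], used as an interpolation
    node. *)
Definition node j (a : nat) : K :=
  if ferm j then (odd a)%:R else a%:R + 2^-1.

Lemma node_inj j D a a' : (ferm j -> (D <= 2)%N) -> (a < D)%N -> (a' < D)%N ->
  node j a = node j a' -> a = a'.
Proof.
rewrite /node; case: ifP => [fj /(_ isT) D2 aD a'D|_ _ _ _].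
  case: a aD => [|[|a]] aD; last lia; case: a' a'D => [|[|a']] a'D //; try lia.
    by move/eqP; rewrite eq_sym oner_eq0.
  by move/eqP; rewrite oner_eq0.
move/addIr => e; wlog le : a a' e / (a <= a')%N.
  by case/orP: (leq_total a a') => le H; [|symmetry]; apply: H.
have /eqP : (a' - a)%:R = 0 :> K by rewrite natrB // e subrr.
by rewrite natr_eq0; lia.
Qed.

(* Collecting powers of [u_j], the values at the weights [0, ..., D-1] in
   coordinate [j] are those of a polynomial of degree less than [D] (with [D = 2]
   for a fermion, since [u_j] is idempotent), so its coefficients vanish. *)
Lemma faithful_vars (L : seq 'I_n) f :
  (forall x, x \in f -> all (fun l => if l is inl k then k \in L else false) x.2) ->
  (forall b, ev b f = 0) -> Krel f.
Proof.
elim: L f => [|j L IH] f supp ev0.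
  (* With no variables left every word is empty, so [f] is a scalar, read off at the weight 0. *)
  apply: (ideal_feq (@Krel_ideal _ _ _ _ gam) _ (ideal0 (@Krel_ideal _ _ _ _ gam))).
  have nilw x : x \in f -> x.2 = [::].
    by move/supp; case: x.2 => // -[k|l] w.
  apply/feq_pairing => F; rewrite pairingE.
  have -> : pairing f F = ev 0 f * F [::]; last by rewrite ev0 mul0r.
  rewrite /ev -pairing_scaler /pairing !big_seq; apply: eq_bigr => x xf.
  by rewrite (nilw x xf) /evw big_nil mul1r.
pose rest w := [seq l <- w | l != inl j] : word.
pose T w := rest w ++ nseq (u_exp j w) (inl j).
(* The coefficient of [u_j ^ d], a combination of words without [u_j]. *)
pose g d := [seq (x.1, rest x.2) | x <- f & u_exp j x.2 == d].
pose D := if ferm j then 2%N else (\max_(x <- f) u_exp j x.2).+1.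
have D2 : ferm j -> (D <= 2)%N by rewrite /D => ->.
have eD x : x \in f -> (u_exp j x.2 < D)%N.
  move=> xf; rewrite /D /u_exp; case: ifP => _; first by rewrite ltnS geq_minr.
  by rewrite ltnS (big_rem x) //= leq_maxl.
have supp_g d x : x \in g d ->
    all (fun l => if l is inl k then k \in L else false) x.2.
  case/mapP=> y; rewrite mem_filter => /andP[_ /supp/allP yf] -> /=.
  apply/allP => l; rewrite mem_filter => /andP[lj /yf].
  by case: l lj => // k kj; rewrite inE => /predU1P[kE|//]; rewrite kE eqxx in kj.
have pairing_g d F : pairing (g d) F =
    \sum_(x <- f | u_exp j x.2 == d) x.1 * F (rest x.2).
  by rewrite /pairing big_map big_filter.
have sum_e (F : nat -> (K * word) -> K) :
    \sum_(d < D) \sum_(x <- f | u_exp j x.2 == d) F d x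
    = \sum_(x <- f) F (u_exp j x.2) x.
  under eq_bigr do rewrite big_mkcond; rewrite exchange_big /= !big_seq.
  apply: eq_bigr => x xf; rewrite (bigD1 (Ordinal (eD x xf))) //= eqxx.
  rewrite big1 ?addr0 // => d dx; case: eqP => // e; case/eqP: dx.
  by apply/val_inj; rewrite /= e.
have ev_g b : ev b f = \sum_(d < D) ev b (g d) * uval K b j ^+ d.
  rewrite /ev; under eq_bigr do rewrite pairing_g big_distrl /=.
  rewrite (sum_e (fun d x => x.1 * evw K b (rest x.2) * uval K b j ^+ d)).
  by apply: eq_bigr => x _; rewrite (evw_u_exp b j) mulrA.
have g0 d b : (d < D)%N -> ev b (g d) = 0.
  move=> dD; pose P := \poly_(d < D) ev b (g d).
  suff P0 : P = 0 by have := coef_poly D (fun d => ev b (g d)) d; rewrite -/P P0 coef0 dD.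
  apply/eqP; apply: contraT => nP.
  pose rs := [seq node j a | a <- iota 0 D].
  have := max_poly_roots (rs := rs) nP; rewrite size_map size_iota ltnNge size_poly.
  apply; last first.
    rewrite map_inj_in_uniq ?iota_uniq // => a a'; rewrite !mem_iota /= !add0n.
    by move=> aD a'D; exact: (node_inj D2).
  apply/allP => _ /mapP[a _ ->]; apply/rootP.
  (* Changing coordinate [j] alone moves [u_j] to the chosen node and leaves every [ev b (g e)]
     unchanged, since [g e] does not involve [u_j]. *)
  pose b' : 'cV[int]_n := \col_k (if k == j then a%:Z else b k 0).
  have := ev0 b'; rewrite ev_g horner_poly; apply: etrans.
  apply: eq_bigr => e _; congr (_ * _ ^+ _); last by rewrite /uval /node mxE eqxx.
  rewrite /ev /pairing !big_seq; apply: eq_bigr => x xg; congr (_ * _).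
  case/mapP: xg => y _ -> /=; rewrite /evw !big_seq; apply: eq_bigr => l.
  rewrite mem_filter => /andP[lj _]; case: l lj => // k kj.
  by rewrite /uval mxE; case: (k =P j) kj => // ->; rewrite eqxx.
have Kg d : (d < D)%N -> Krel (g d).
  by move=> dD; apply: IH => [x|b]; [exact: supp_g|exact: g0].
apply: (@keq_Krel _ _ _ _ _ _ [seq (x.1, T x.2) | x <- f]).
  apply: keq_map => x xf; apply: keq_u_exp; apply: sub_all (supp x xf) => -[] //.
(* The sum is reassembled from the products [g d * u_j ^ d], each in the ideal because [g d] is. *)
apply: (@ideal_feq _ _ _ _ _ (@Krel_ideal _ _ _ _ gam)
  (flatten [seq fmul (g d) (mon K (nseq d (inl j))) | d : 'I_D])); last first.
  by apply: (ideal_sum (@Krel_ideal _ _ _ _ gam)) => d; apply: fidealMr (Kg _ _);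
     [exact: Krel_ideal|].
apply/feq_pairing => F; rewrite /pairing big_flatten /= big_image /=.
under eq_bigr => d _ do rewrite -/(pairing _ _) pairingE pairing_g.
rewrite (sum_e (fun d x => x.1 * pairing (mon K (nseq d (inl j)))
  (fun v => F (rest x.2 ++ v)))) big_map.
by apply: eq_bigr => x _; rewrite pairingE.
Qed.

Lemma faithful f : isR f -> (forall b, ev b f = 0) -> Krel f.
Proof.
move=> /allP Rf; apply: (@faithful_vars (enum 'I_n)) => x /Rf.
by apply: sub_all => -[k|//] _; rewrite mem_enum.
Qed.

End GradedPieces.

(** * The support *)

Section Support.
Variable K : fieldType.
Hypothesis char0 : [pchar K] =i pred0.
Variables p q m : nat.
Local Notation n := (p + q)%N.
Local Notation word := (word p q m).
Local Notation letter := (letter p q m).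
Local Notation fsum := (fsum K p q m).
Variable gam : 'M[int]_(n, m).
Hypothesis gam_cond : gamma_cond gam.
Local Notation ferm k := (p <= (k : 'I_n))%N.
Local Notation state := ('cV[int]_n * 'cV[int]_m)%type.
Local Notation Krel := (@Krel K p q m gam).
Local Notation X := (@X p q m).
Local Notation Y := (@Y p q m).
Implicit Types (f h r : fsum) (u v w : word) (i : 'I_m) (b : 'cV[int]_n)
  (j k : 'I_n) (s : state) (g : 'I_m -> int).

(** A homogeneous formal sum may list words of other degrees, but their coefficients cancel. *)
Lemma homog_component g f : homog g f -> feq f (component g f).
Proof.
move=> hf w; rewrite /coef /component big_filter_cond.
have [/eqP c0|/hf dw] := eqVneq (coef f w) 0.
  move: c0 => /eqP; rewrite /coef => c0.
  have [dw|dw] := boolP [forall i, deg w i == g i].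
    by apply: eq_bigl => x; case: eqP => [->|]; rewrite ?dw ?andbF.
  by rewrite c0 big_pred0 // => x; case: eqP => [->|]; rewrite ?(negbTE dw) ?andbF.
apply: eq_bigl => x; case: eqP => [->|]; rewrite ?andbF // andbT.
by symmetry; apply/forallP => i; rewrite dw.
Qed.

(** In the normal form each index occurs equally often among the [X] and the [Y]. Disjointness then
    leaves both blocks empty. *)
Lemma deg0_keq_R w : (forall i, deg w i = 0) ->
  exists r, isR r /\ keq gam (mon K w) r.
Proof.
move=> d0; have [xs [ys [disj [r [Rr e]] dw]]] := normal_form K gam w.
have eq_count i : count_mem i xs = count_mem i ys.
  by have := dw i; rewrite d0; lia.
have xs0 : xs = [::].
  case: xs disj eq_count {dw e} => // i xs disj /(_ i).
  rewrite /= eqxx => c; have := disj i (mem_head _ _).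
  by rewrite -has_pred1 has_count -c.
have ys0 : ys = [::].
  by case: ys eq_count {disj dw e} => // i ys /(_ i); rewrite xs0 /= eqxx.
move: e; rewrite xs0 ys0 /= => e; exists r; split=> //.
apply: (keq_trans e); apply: feq_keq; exact: fmulf1.
Qed.

Lemma homog0_keq_R f : homog (fun=> 0) f -> exists r, isR r /\ keq gam f r.
Proof.
move=> /homog_component /(@feq_keq _ _ _ _ gam) e.
suff [r [Rr e']] : exists r, isR r /\ keq gam (component (fun=> 0) f) r.
  by exists r; split=> //; exact: keq_trans e e'.
have : all (fun x => [forall i, deg x.2 i == 0]) (component (fun=> 0) f).
  by rewrite /component filter_all.
elim: (component _ f) => [|[c w] t IH] /=.
  by move=> _; exists [::]; split=> //; exact: keq_refl.
case/andP=> /forallP d0 /IH [r [Rr e1]].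
have [r' [Rr' e2]] := deg0_keq_R (fun i => eqP (d0 i)).
exists (fadd (fscale c r') r); split.
  by apply: isR_fadd => //; exact: isR_fscale.
apply: (@keq_trans _ _ _ _ _ _ (fadd (fscale c (mon K w)) t)).
  apply: feq_keq; apply/feq_pairing => F.
  by rewrite !pairingE pairing_cons.
by apply: fadd_keq => //; exact: fscale_keq.
Qed.

(** In degree zero an annihilating element is congruent to some [r] in [R] that evaluates to 0 at
    every weight, and [faithful] applies. *)
Lemma vanishing_admissible : admissible gam (@vanishing K p q m gam).
Proof.
split=> [|||f vf hf].
- exact: vanishing_ideal.
- exact: vanishing_graded.
- by move=> f; exact: Krel_vanishing.
have [r [Rr e]] := homog0_keq_R hf; apply: (keq_Krel e).
apply: faithful => // b.
have := Krel_vanishing gam_cond e (fun=> 1) (b, 0).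
by rewrite act_sub vf act_isR // mulr1 sub0r => /eqP; rewrite oppr_eq0 => /eqP.
Qed.

Lemma nonvanishing_word g f : homog g f -> ~ vanishing gam f ->
  exists w s, (forall i, deg w i = g i) /\ wcoef K gam w s != 0.
Proof.
move=> hf nv; apply: NNPP => none; apply: nv => phi s.
have /feq_pairing fE := homog_component hf.
rewrite /act fE /pairing /component big_filter big1 // => x /forallP dx.
have [->|nz] := eqVneq (wcoef K gam x.2 s) 0; first by rewrite mul0r mulr0.
by case: none; exists x.2, s; split=> // i; apply/eqP.
Qed.

(** Testing on the constant function 1 shows that the first coefficient is a multiple of the
    second. *)
Lemma wcoef_red w w' s : red K gam w w' -> wcoef K gam w s != 0 ->
  wcoef K gam w' s != 0.
Proof.
case=> r [Rr e]; have := Krel_vanishing gam_cond e (fun=> 1) s.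
rewrite act_sub act_mul (act_isR _ _ _ Rr) !act_mon !mulr1 => /eqP.
by rewrite subr_eq0 => /eqP ->; apply: contra_neq => ->; rewrite mulr0.
Qed.

(** If [w] lay in an admissible ideal, [invw w ++ w] would lie there in degree zero, hence in
    [Krel], and act by 0. At the state [s - wstep gam w] its coefficient is nonzero. *)
Lemma nonzero_of_word g w s : all (fun l => ~~ is_u l) w ->
  (forall i, deg w i = g i) -> wcoef K gam w s != 0 -> A_nonzero K gam g.
Proof.
move=> uw dw nz; have iw_nz := wcoef_invw char0 gam_cond uw nz.
have coef_mon v v' : coef (mon K v) v' = (v == v')%:R.
  by rewrite coef_pairing pairing_mon.
have homog_mon v g' : (forall i, deg v i = g' i) -> homog g' (mon K v).
  by move=> dv v'; rewrite coef_mon; case: (v =P v') => [<- _ //|_]; rewrite eqxx.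
exists (mon K w); split; first exact: homog_mon.
case=> J [[idJ _ _ J0] Jw].
have : Krel (mon K (invw w ++ w)).
  apply: J0.
    apply: (ideal_feq idJ _ (fidealMl idJ (mon K (invw w)) Jw)).
    by symmetry; exact: mon_cat.
  apply: homog_mon => i; rewrite -(wstep_deg gam) wstep_cat wstep_invw addNr.
  by rewrite mxE.
move/(Krel_vanishing gam_cond)/(_ (fun=> 1) (s - wstep gam w)).
rewrite act_mon mulr1 wcoef_cat wstep_invw opprK subrK => /eqP.
by rewrite mulf_eq0 (negbTE iw_nz) (negbTE nz).
Qed.

Lemma size_sum_count (T : finType) (t : seq T) :
  size t = (\sum_(x : T) count_mem x t)%N.
Proof.
elim: t => [|y t IH]; first by rewrite big1.
rewrite /= big_split /= -IH (bigD1 y) //= eqxx big1 ?addn0 // => x xy.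
by rewrite eq_sym (negbTE xy).
Qed.

Definition signed_letter g i : letter := if 0 < g i then X i else Y i.

Lemma step_signed_letter g i k : g i != 0 ->
  (step gam (signed_letter g i)).1 k 0 = sgz (g i) * gam k i.
Proof.
rewrite /signed_letter; case: ltrgt0P => // gi _ /=; rewrite !mxE.
  by rewrite gtr0_sgz // mul1r.
by rewrite ltr0_sgz // mulN1r.
Qed.

Lemma ldeg_signed_letter g i i' : g i != 0 ->
  ldeg (signed_letter g i) i' = sgz (g i) * (i == i')%:Z.
Proof.
rewrite /signed_letter; case: ltrgt0P => // gi _ /=.
  by rewrite gtr0_sgz // mul1r.
by rewrite ltr0_sgz // mulN1r.
Qed.

Lemma support_criterion g :
  A_nonzero K gam g <->
  exists t : seq 'I_m,
    size t = (\sum_(i < m) absz (g i))%N /\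
    (forall i : 'I_m, count_mem i t = absz (g i)) /\
    (forall r : 'I_(p + q), (p <= r)%N ->
       ~ has_bad_block [seq sgz (g i) * gam r i | i <- t]).
Proof.
split.
  case=> f [hf nI]; have nv : ~ vanishing gam f.
    by move=> vf; apply: nI; exists (@vanishing K p q m gam); split; [exact: vanishing_admissible|].
  have [w [s [dw nz]]] := nonvanishing_word hf nv.
  (* The indices of the reduced word form the required sequence; disjointness turns the signed
     counts into [|g_i|]. *)
  have [xs [ys [disj rw dxy]]] := normal_form K gam w.
  have {}nz := wcoef_red rw nz.
  have c0 i : i \in xs -> count_mem i ys = 0%N.
    by move=> /disj ?; apply/count_memPn.
  have cg i : count_mem i (ys ++ xs) = absz (g i).
    rewrite count_cat; have := dxy i; rewrite dw.
    have [/c0|/count_memPn] := boolP (i \in xs); lia.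
  exists (ys ++ xs); split; first by rewrite size_sum_count; apply: eq_bigr => i _.
  split=> // r fr.
  have gneg i : i \in ys -> g i < 0.
    move=> iy; have cy : (0 < count_mem i ys)%N by rewrite -has_count has_pred1.
    have ix : i \notin xs by apply: contraL iy; exact: disj.
    by have := dxy i; rewrite dw (count_memPn ix); lia.
  have gpos i : i \in xs -> 0 < g i.
    move=> ix; have cx : (0 < count_mem i xs)%N by rewrite -has_count has_pred1.
    by have := dxy i; rewrite dw (c0 _ ix); lia.
  have := nz; rewrite wcoef_neq0 //; last first.
    by rewrite all_cat !all_map; apply/andP; split; apply/allP.
  move/forallP/(_ r); rewrite fr /= => /alternating_no_block.
  suff -> : row_steps gam r (map Y ys ++ map X xs)
    = [seq sgz (g i) * gam r i | i <- ys ++ xs] by [].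
  rewrite /row_steps !map_cat -!map_comp; congr (_ ++ _);
    apply/eq_in_map => i ii /=; rewrite !mxE.
    by rewrite ltr0_sgz ?gneg // mulN1r.
  by rewrite gtr0_sgz ?gpos // mul1r.
case=> t [_ [ct nb]].
have gt0 i : i \in t -> g i != 0.
  by move=> it; have := ct i; have : (0 < count_mem i t)%N;
    [rewrite -has_count has_pred1|lia].
pose w : word := map (signed_letter g) t.
have uw : all (fun l => ~~ is_u l) w.
  by apply/allP => _ /mapP[i _ ->]; rewrite /signed_letter; case: ifP.
have rowE k : row_steps gam k w = [seq sgz (g i) * gam k i | i <- t].
  rewrite /row_steps -map_comp; apply/eq_in_map => i it /=.
  exact: step_signed_letter (gt0 i it).
have start k : exists y, ferm k -> alternating y (row_steps gam k w).
  have [fk|] := boolP (ferm k); last by exists true.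
  have [||y ay] := @no_block_alternating (row_steps gam k w).
  - move=> d; rewrite rowE => /mapP[i it ->].
    rewrite normrM (_ : `|sgz (g i)| = 1) ?mul1r; first exact: gam_ferm.
    by case: (sgzP (g i)) (gt0 i it) => // ->; rewrite eqxx.
  - by rewrite rowE; exact: nb.
  by exists y.
have [y ay] : exists y : 'I_n -> bool,
    forall k, ferm k -> alternating (y k) (row_steps gam k w).
  (* Alternation is a boolean condition, so the initial parities of the rows can be chosen
     simultaneously. *)
  have D k : {y : bool | ferm k ==> alternating y (row_steps gam k w)}.
    by apply: sigW; have [y ay] := start k; exists y; apply/implyP.
  by exists (fun k => sval (D k)) => k; apply/implyP; exact: (svalP (D k)).
(* The weight has the chosen parities as coordinates, with values 0 and 1; bosonic coordinates and
   the degree are unconstrained. *)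
apply: (@nonzero_of_word g w (\col_k (y k : nat)%:Z, 0)) => //.
- move=> i; rewrite /deg big_map big_seq.
  under eq_bigr => k kt do rewrite ldeg_signed_letter ?gt0 //.
  rewrite -big_seq.
  transitivity (sgz (g i) * (count_mem i t)%:Z); last first.
    by rewrite ct; case: (sgzP (g i)); lia.
  elim: t {ct nb gt0 w uw rowE start y ay} => [|k t IH] /=.
    by rewrite big_nil mulr0.
  by rewrite big_cons IH PoszD mulrDr; case: eqP => [->|] //; rewrite !mulr0.
- rewrite wcoef_neq0 //; apply/forallP => k; apply/implyP => fk.
  by rewrite /= mxE; case: (y k) (ay k fk).
Qed.

End Support.

Theorem mainTheorem9 (K : closedFieldType) (Hchar : [pchar K] =i pred0)
  (p q m : nat) (gam : 'M[int]_(p + q, m)) (Hgam : gamma_cond gam)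
  (g : 'I_m -> int) :
  A_nonzero K gam g <->
  exists s : seq 'I_m,
    size s = (\sum_(i < m) absz (g i))%N /\
    (forall i : 'I_m, count_mem i s = absz (g i)) /\
    (forall r : 'I_(p + q), (p <= r)%N ->
       ~ has_bad_block [seq sgz (g i) * gam r i | i <- s]).
Proof. exact: support_criterion. Qed.
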